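(* Fix a positive integer $m$ and an integer $\ell\ge2$, and let $\Lambda=S_\ell$ be the star with $\ell$ edges (one center and $\ell$ leaves). Let $W_n$ be the number of copies of $\Lambda$ in the uniform attachment graph $G^m_n$, let $\mu_n:=\mathbb{E}W_n$, $\sigma_n^2:=\mathrm{Var}(W_n)$, and $Y_n:=(W_n-\mu_n)/\sigma_n$. Then, as $n\to\infty$, $$\sigma_n^2=\Theta(n),$$ and thus there is a constant $C=C(m,\ell)$ such that, for all sufficiently large $n$, $$d_{\mathrm{W}}\bigl(\mathcal{L}(Y_n),\mathcal{N}(0,1)\bigr)\le Cn^{-1/2}.$$
   Context: Uniform attachment graph: for integers $m,n\ge1$, $G^m_n$ is the random loopless multigraph on vertex set $[n]=\{1,\dots,n\}$ in which, for every $j\in\{2,\dots,n\}$ and every label $a\in[m]$, there is exactly one edge $j^{(a)}$ with label $a$ from $j$ to a vertex chosen uniformly at random in $[j-1]$, all choices being independent. Parallel edges are allowed and are distinguished by their labels (equivalently, $G^m_n$ is a random subgraph of the multigraph $K^m_n$ on $[n]$ having, for every $1\le i<j\le n$, $m$ edges $ji^{(1)},\dots,ji^{(m)}$ between $j$ and $i$). Copies: a copy of a graph $H$ in $G^m_n$ is a (not necessarily induced) subgraph of $G^m_n$ isomorphic to $H$ as an undirected, unlabelled multigraph; two copies are different if they differ as subgraphs (also if they differ only in edge labels). $\mathcal{L}(X)$ is the law of $X$, $\mathcal{N}(0,1)$ the standard normal distribution. The Wasserstein distance is $d_{\mathrm{W}}(\nu_1,\nu_2)=\sup_f|\int f\,d\nu_1-\int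 f\,d\nu_2|$, supremum over all $f:\mathbb{R}\to\mathbb{R}$ with $|f(x)-f(y)|\le|x-y|$ for all $x,y$. $a_n=\Theta(b_n)$ means that there are constants $0<c\le C'<\infty$ not depending on $n$ with $cb_n\le a_n\le C'b_n$ for all sufficiently large $n$. *)

(* Defs.v *)
From HB Require Import structures.
From mathcomp Require Import all_boot all_order all_algebra.
From mathcomp Require Import all_classical all_reals all_analysis.

Set Implicit Arguments.
Unset Strict Implicit.
Unset Printing Implicit Defensive.

Import Order.TTheory GRing.Theory Num.Theory.
Import numFieldNormedType.Exports.

Local Open Scope classical_set_scope.
Local Open Scope ring_scope.

Record multigraph := Multigraph {
  vertex : finType;
  edge : finType;
  endpoints : edge -> {set vertex};
  endpoints_card : forall e, #|endpoints e| = 2%N }.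

(* A subgraph of G is a pair (vertex set, edge set) whose edges have both
   endpoints in the vertex set. Parallel edges are distinct elements of
   [edge G], so subgraphs that differ only in edge labels are different. *)
Definition is_subgraph (G : multigraph)
    (S : {set vertex G} * {set edge G}) : bool :=
  [forall e in S.2, endpoints e \subset S.1].

(* f is a bijection from the vertices of H onto those of S, and g one from the
   edges of H onto those of S, respecting endpoints. *)
Definition isomorphic_to_subgraph (H G : multigraph)
    (S : {set vertex G} * {set edge G}) : bool :=
  [exists f : {ffun vertex H -> vertex G},
   exists g : {ffun edge H -> edge G},
     [&& injectiveb f, f @: [set: vertex H]%SET == S.1,
         injectiveb g, g @: [set: edge H]%SET == S.2 &
         [forall e, endpoints (g e) == f @: endpoints e]]].

Definition copies (H G : multigraph) : {set {set vertex G} * {set edge G}} :=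
  [set S | is_subgraph S && isomorphic_to_subgraph H S]%SET.

Definition star_endpoints (l : nat) (e : 'I_l) : {set 'I_l.+1} :=
  [set ord0; lift ord0 e]%SET.

Lemma star_endpoints_card l (e : 'I_l) : #|star_endpoints e| = 2%N.
Proof. by rewrite cards2 neq_lift. Qed.

Definition star (l : nat) : multigraph := Multigraph (@star_endpoints_card l).

(* The vertices 1, ..., n are represented by the elements 0, ..., n - 1 of
   'I_n. The pair (j, a) : 'I_n.-1 * 'I_m stands for the edge labelled a that
   is sent by the vertex j + 1 of 'I_n to one of the j + 1 vertices 0, ..., j;
   an attachment records all these choices. *)
Definition attachment (m n : nat) : Type :=
  {dffun forall p : 'I_n.-1 * 'I_m, 'I_p.1.+1}.

HB.instance Definition _ m n := Finite.on (attachment m n).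

Definition attachment0 m n : attachment m n := [ffun p => ord0].

HB.instance Definition _ m n :=
  isPointed.Build (attachment m n) (attachment0 m n).

HB.instance Definition _ m n :=
  @isMeasurable.Build default_measure_display (attachment m n)
    discrete_measurable discrete_measurable0
    discrete_measurableC discrete_measurableU.

Lemma new_vertex_subproof n (j : 'I_n.-1) : (j.+1 < n)%N.
Proof. by case: n j => [[]|n j] //=; rewrite ltnS. Qed.

Definition new_vertex n (j : 'I_n.-1) : 'I_n :=
  Ordinal (new_vertex_subproof j).

Definition old_vertex n (j : 'I_n.-1) (i : 'I_j.+1) : 'I_n :=
  widen_ord (ltnW (new_vertex_subproof j)) i.

Definition ua_endpoints m n (w : attachment m n) (p : 'I_n.-1 * 'I_m) :
    {set 'I_n} :=
  [set new_vertex p.1; old_vertex (w p)]%SET.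

Lemma ua_endpoints_card m n (w : attachment m n) p :
  #|ua_endpoints w p| = 2%N.
Proof.
rewrite cards2; case: eqP => // /(congr1 val) /= Ew.
by have := ltn_ord (w p); rewrite -Ew ltnn.
Qed.

Definition ua_graph m n (w : attachment m n) : multigraph :=
  Multigraph (ua_endpoints_card w).

(* Independent uniform choices: the edge p has p.1.+1 equiprobable targets. *)
Definition ua_pmf (R : realType) m n (w : attachment m n) : R :=
  \prod_(p : 'I_n.-1 * 'I_m) (p.1.+1%:R)^-1.

Definition ua_prob (R : realType) m n (A : set (attachment m n)) : \bar R :=
  (\sum_(w : attachment m n) (ua_pmf R w)%:E * \d_w A)%E.

Section ua_prob_is_probability.
Context (R : realType) (m n : nat).
Local Notation P := (@ua_prob R m n).

Lemma ua_pmf_ge0 (w : attachment m n) : 0 <= ua_pmf R w.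
Proof. by apply: prodr_ge0 => p _; rewrite invr_ge0. Qed.

Let P0 : P set0 = 0%E.
Proof. by rewrite /ua_prob big1 // => w _; rewrite measure0 mule0. Qed.

Let P_ge0 A : (0 <= P A)%E.
Proof.
apply: sume_ge0 => w _; apply: mule_ge0 => //.
by rewrite lee_fin ua_pmf_ge0.
Qed.

Let P_sigma_additive : semi_sigma_additive P.
Proof.
pose mu k : {measure set (attachment m n) -> \bar R} :=
  if insub k is Some i then
    mscale (NngNum (ua_pmf_ge0 (enum_val (i : 'I_#|{: attachment m n}|))))
      (dirac (enum_val i))
  else mzero.
have -> : P = msum mu #|{: attachment m n}|.
  apply/funext => A; rewrite /ua_prob /msum.
  rewrite (reindex (@enum_val _ {: attachment m n})) /=; last first.
    by apply: onW_bij; exact: enum_val_bij.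
  by apply: eq_bigr => i _; rewrite /mu valK.
exact: measure_semi_sigma_additive.
Qed.

HB.instance Definition _ :=
  isMeasure.Build _ _ _ P P0 P_ge0 P_sigma_additive.

Let P_setT : P [set: _] = 1%E.
Proof.
rewrite /ua_prob; under eq_bigr do rewrite diracT mule1.
rewrite sumEFin sumr_const; congr EFin.
have -> : #|{: attachment m n}| =
    (\prod_(p : 'I_n.-1 * 'I_m) p.1.+1)%N.
  rewrite card_dep_ffun foldrE big_map big_enum /=.
  by apply: eq_bigr => p _; rewrite card_ord.
rewrite /ua_pmf prodfV -natr_prod -[LHS]mulr_natr mulVf // pnatr_eq0 -lt0n.
exact: prodn_gt0.
Qed.

HB.instance Definition _ := @Measure_isProbability.Build _ _ R P P_setT.

End ua_prob_is_probability.

Definition copy_count (R : realType) (H : multigraph) m n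
    (w : attachment m n) : R :=
  #|copies H (ua_graph w)|%:R.

Definition mean (R : realType) (H : multigraph) m n : R :=
  fine 'E_(@ua_prob R m n)[@copy_count R H m n].

Definition sigma2 (R : realType) (H : multigraph) m n : R :=
  fine 'V_(@ua_prob R m n)[@copy_count R H m n].

Definition sigma (R : realType) (H : multigraph) m n : R :=
  Num.sqrt (sigma2 R H m n).

(* [measurableTypeR R] is R with its Borel sigma-algebra, on which the library
   defines [normal_prob]. *)
Definition standardized_count (R : realType) (H : multigraph) m n
    (w : attachment m n) : measurableTypeR R :=
  (copy_count R H w - mean R H m n) / sigma R H m n.

Lemma measurable_standardized_count (R : realType) (H : multigraph) m n :
  measurable_fun [set: attachment m n] (@standardized_count R H m n).
Proof. by []. Qed.

HB.instance Definition _ (R : realType) (H : multigraph) m n :=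
  isMeasurableFun.Build _ _ (attachment m n) (measurableTypeR R)
    (@standardized_count R H m n) (@measurable_standardized_count R H m n).

Definition law_standardized_count (R : realType) (H : multigraph) m n :
    probability (measurableTypeR R) R :=
  distribution (@ua_prob R m n) (@standardized_count R H m n).

Definition wasserstein (R : realType)
    (nu1 nu2 : probability (measurableTypeR R) R) : \bar R :=
  ereal_sup [set `|\int[nu1]_x (f x)%:E - \int[nu2]_x (f x)%:E|%E
            | f in [set f : R -> R | forall x y, `|f x - f y| <= `|x - y|]].

Definition is_Theta (R : realType) (a b : nat -> R) : Prop :=
  exists c C : R, [/\ 0 < c, c <= C &
    \forall n \near \oo, c * b n <= a n <= C * b n].

(* Main.v *)
(** Write the number of stars as a function [W] of the independent choices.
    Interpolating from the choices [w] to an independent copy [v] one edge at a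
    time gives an exact covariance formula, hence both the Efron-Stein inequality
    and [E (Y F(Y)) = E (F'(Y) T / sigma^2) + error], where [T] is the average of
    the products of two discrete derivatives of [W], [E T = sigma^2], and the
    error is cubic in these derivatives.  With Stein's equation it remains to
    bound [Var T] and the third moments by [O(n)].  Every derivative of first or
    second order is at most a power of the number of edges touching the resampled
    one in the union of the copies involved, so all these bounds reduce to
    [E (sum_x deg(x)^k) = O(n)], which follows from
    [E (sum_x (1 + t)^deg(x)) = O(n)] for small [t > 0].

    For the lower bound on the variance, [W] is tested against the number [S] of
    late vertices whose edge labelled 0 is sent below [k], where [k] is a small
    multiple of [n]: such an edge lies in many stars on average, since
    the expected degree of a vertex below [k] is of order [log (n / k)], whereas a
    late edge lies in [O(1)] stars on average; hence [Cov(W, S)] is of order [n]. *)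
From mathcomp Require Import all_boot all_order all_algebra.
From mathcomp Require Import zify ring lra.
Require Import Defs.

Set Implicit Arguments.
Unset Strict Implicit.
Unset Printing Implicit Defensive.

Import Order.TTheory GRing.Theory Num.Theory.

Local Open Scope ring_scope.

(** * Functions of independent variables *)

Section product_space.
Variables (R : realFieldType) (I : finType) (T : I -> finType).
Variable q : forall p, T p -> R.
Arguments q : clear implicits.
Hypothesis q_ge0 : forall p x, 0 <= q p x.
Hypothesis q_sum1 : forall p, \sum_x q p x = 1.

Notation Om := {dffun forall p : I, T p}.
Implicit Types (w v : Om) (f g : Om -> R) (A : pred I).

(** Distributivity of products over sums. As the types [T p] differ, the sums are first moved to the
    tagged union of all [T p], where the choices form an ordinary function space. *)
Lemma sum_dffun_prod (g : forall p, T p -> R) :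
  \sum_(w : Om) \prod_p g p (w p) = \prod_p \sum_x g p x.
Proof.
pose P p : {ffun T p -> R} := [ffun x => g p x].
have -> : \prod_p \sum_x g p x =
    \prod_p \sum_(j in tagged_with T p) untag 0 (P p) j.
  apply: eq_bigr => p _; transitivity (\sum_x P p x).
    by apply: eq_bigr => x _; rewrite ffunE.
  exact: (big_tag (fun p x => P p x) p).
rewrite bigA_distr_big_dep -big_fprod.
rewrite (reindex (@fprod_of_dffun I T)); last first.
  by apply: onW_bij; exact: fprod_of_dffun_bij.
by apply: eq_bigr => w _; apply: eq_bigr => p _; rewrite fprodE ffunE.
Qed.

Definition pm w := \prod_p q p (w p).

Definition avg f := \sum_w pm w * f w.

Lemma pm_ge0 w : 0 <= pm w.
Proof. by rewrite prodr_ge0. Qed.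

Lemma avg_prod (g : forall p, T p -> R) :
  avg (fun w => \prod_p g p (w p)) = \prod_p \sum_x q p x * g p x.
Proof.
rewrite -sum_dffun_prod; apply: eq_bigr => w _.
by rewrite /pm -big_split.
Qed.

Lemma avg_ext f g : f =1 g -> avg f = avg g.
Proof. by move=> fg; apply: eq_bigr => w _; rewrite fg. Qed.

Lemma pm_sum1 : \sum_w pm w = 1.
Proof. by rewrite sum_dffun_prod big1. Qed.

Lemma avg_cst c : avg (fun=> c) = c.
Proof. by rewrite /avg -mulr_suml pm_sum1 mul1r. Qed.

Lemma avgD f g : avg (fun w => f w + g w) = avg f + avg g.
Proof. by rewrite -big_split; apply: eq_bigr => w _; rewrite mulrDr. Qed.

Lemma avgB f g : avg (fun w => f w - g w) = avg f - avg g.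
Proof. by rewrite -sumrB; apply: eq_bigr => w _; rewrite mulrBr. Qed.

Lemma avgZ c f : avg (fun w => c * f w) = c * avg f.
Proof. by rewrite mulr_sumr; apply: eq_bigr => w _; rewrite mulrCA. Qed.

Lemma avgZr c f : avg (fun w => f w * c) = avg f * c.
Proof. by rewrite mulr_suml; apply: eq_bigr => w _; rewrite mulrA. Qed.

Lemma avg_sum (J : Type) (r : seq J) (P : pred J) (F : J -> Om -> R) :
  avg (fun w => \sum_(j <- r | P j) F j w) = \sum_(j <- r | P j) avg (F j).
Proof. by rewrite exchange_big; apply: eq_bigr => w _; rewrite mulr_sumr. Qed.

Lemma avg_le f g : (forall w, f w <= g w) -> avg f <= avg g.
Proof. by move=> fg; apply: ler_sum => w _; rewrite ler_wpM2l ?pm_ge0. Qed.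

Lemma avg_ge0 f : (forall w, 0 <= f w) -> 0 <= avg f.
Proof. by move=> f0; rewrite -(avg_cst 0) avg_le. Qed.

Lemma avg_norm f : `|avg f| <= avg (fun w => `|f w|).
Proof.
rewrite (le_trans (ler_norm_sum _ _ _))// ler_sum// => w _.
by rewrite normrM ger0_norm ?pm_ge0.
Qed.

Definition var f := avg (fun w => f w ^+ 2) - avg f ^+ 2.

Lemma varE f : var f = avg (fun w => (f w - avg f) ^+ 2).
Proof.
rewrite /var [RHS](avg_ext (g := fun w => f w ^+ 2 - (2 * avg f) * f w + avg f ^+ 2)).
  by rewrite avgD avgB avgZ avg_cst; ring.
by move=> w; ring.
Qed.

Lemma avg_sqr_le f : avg f ^+ 2 <= avg (fun w => f w ^+ 2).
Proof. by rewrite -subr_ge0 -/(var f) varE avg_ge0// => w; rewrite sqr_ge0. Qed.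

Definition mix A w v : Om := [ffun p => if A p then v p else w p].

Lemma mixE A w v p : mix A w v p = if A p then v p else w p.
Proof. by rewrite ffunE. Qed.

(** Exchanging the coordinates in [A] between two independent copies preserves their joint law: at
    each coordinate the two weights are at most interchanged. *)
Lemma avg2_swap A (h : Om -> Om -> R) :
  avg (fun w => avg (fun v => h w v)) =
  avg (fun w => avg (fun v => h (mix A w v) (mix A v w))).
Proof.
rewrite /avg; under eq_bigr do rewrite mulr_sumr.
under [RHS]eq_bigr do rewrite mulr_sumr.
rewrite !pair_bigA /=.
pose sw (x : Om * Om) : Om * Om := (mix A x.1 x.2, mix A x.2 x.1).
have swK : involutive sw.
  move=> [w v]; rewrite /sw /=; congr (_, _); apply/ffunP => p;
    by rewrite !mixE; case: (A p).
rewrite (reindex_inj (inv_inj swK)) /=; apply: eq_bigr => -[w v] _ /=.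
rewrite !mulrA; congr (_ * _); rewrite /pm -!big_split; apply: eq_bigr => p _.
by rewrite /= !mixE; case: ifP => // _; rewrite mulrC.
Qed.

(** The interpolation from [w] to [v] replaces coordinates in enumeration order; its step at [p]
    leads from [mix (before p) w v] to [mix (upto p) w v]. *)
Definition before (p : I) := [pred r : I | (enum_rank r < enum_rank p)%N].
Definition upto (p : I) := [pred r : I | (enum_rank r <= enum_rank p)%N].

(** Exchanging coordinate [p] between [w] and [v] interchanges the two ends of the step at [p]; with
    the next lemma, [path_incr f p] changes sign. *)
Lemma mix_upto_before p w v :
  mix (upto p) (mix (pred1 p) w v) (mix (pred1 p) v w) = mix (before p) w v.
Proof.
apply/ffunP => r; rewrite !mixE /=; case: (eqVneq r p) => [->|rp].
  by rewrite leqnn ltnn.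
by rewrite [in RHS]ltn_neqAle (inj_eq val_inj) (inj_eq enum_rank_inj) rp.
Qed.

Lemma mix_before_upto p w v :
  mix (before p) (mix (pred1 p) w v) (mix (pred1 p) v w) = mix (upto p) w v.
Proof.
apply/ffunP => r; rewrite !mixE /=; case: (eqVneq r p) => [->|rp].
  by rewrite leqnn ltnn.
by rewrite [in LHS]ltn_neqAle (inj_eq val_inj) (inj_eq enum_rank_inj) rp.
Qed.

Lemma mix_single_before p w v :
  mix (pred1 p) (mix (before p) w v) (mix (before p) v w) = mix (upto p) w v.
Proof.
apply/ffunP => r; rewrite !mixE /=; case: (eqVneq r p) => [->|rp].
  by rewrite leqnn ltnn.
by rewrite [in LHS]ltn_neqAle (inj_eq val_inj) (inj_eq enum_rank_inj) rp.
Qed.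

Definition incr f p w v := f w - f (mix (pred1 p) w v).
Definition path_incr f p w v := f (mix (before p) w v) - f (mix (upto p) w v).

Lemma sum_path_incr f w v : \sum_p path_incr f p w v = f w - f v.
Proof.
pose F k := - f (mix [pred r | (enum_rank r < k)%N] w v).
transitivity (\sum_(k < #|I|) (F k.+1 - F k)).
  rewrite (reindex (@enum_rank I)) /=; last first.
    by apply: onW_bij; exact: enum_rank_bij.
  by apply: eq_bigr => p _; rewrite /path_incr /F opprK addrC.
rewrite -(big_mkord xpredT (fun k => F k.+1 - F k)) telescope_sumr//.
rewrite /F opprK addrC; congr (f _ - f _); apply/ffunP => p; rewrite !mixE//=.
by rewrite ltn_ord.
Qed.

(* Interpolate from [w] to its independent copy [v] one coordinate at a time;
   swapping the resampled coordinate symmetrises each increment. *)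
Lemma covariance_interpolation g f :
  avg (fun w => g w * f w) - avg g * avg f =
  2^-1 * \sum_p avg (fun w => avg (fun v => incr g p w v * path_incr f p w v)).
Proof.
have -> : avg (fun w => g w * f w) - avg g * avg f =
    \sum_p avg (fun w => avg (fun v => g w * path_incr f p w v)).
  rewrite -avg_sum.
  rewrite [RHS](avg_ext (g := fun w => g w * f w - g w * avg f)).
    by rewrite avgB avgZr.
  move=> w; rewrite -avg_sum [LHS](avg_ext (g := fun v => g w * (f w - f v))).
    by rewrite avgZ avgB avg_cst mulrBr.
  by move=> v; rewrite -mulr_sumr sum_path_incr.
rewrite mulr_sumr; apply: eq_bigr => p _.
set S := LHS.
have hS : S = - avg (fun w => avg (fun v => g (mix (pred1 p) w v) * path_incr f p w v)).
  rewrite /S (avg2_swap (pred1 p)) -mulN1r -avgZ; apply: avg_ext => w.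
  rewrite -avgZ; apply: avg_ext => v.
  by rewrite /path_incr mix_upto_before mix_before_upto; ring.
have -> : avg (fun w => avg (fun v => incr g p w v * path_incr f p w v)) = S + S.
  rewrite {2}hS -avgB; apply: avg_ext => w; rewrite -avgB; apply: avg_ext => v.
  by rewrite /incr mulrBl.
by field.
Qed.

(** The step at [p] is a resampling at [p] applied to the hybrids [mix (before p) w v] and
    [mix (before p) v w], whose joint law is that of [w] and [v]. *)
Lemma avg_path_incr (h : R -> R) f p :
  avg (fun w => avg (fun v => h (path_incr f p w v))) =
  avg (fun w => avg (fun v => h (incr f p w v))).
Proof.
rewrite [RHS](avg2_swap (before p)); apply: avg_ext => w; apply: avg_ext => v.
by rewrite /incr mix_single_before.
Qed.

(** Bound each product of increments in the covariance formula by half the sum of the squares; both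
    squares have the same average. *)
Lemma efron_stein f :
  var f <= 2^-1 * \sum_p avg (fun w => avg (fun v => incr f p w v ^+ 2)).
Proof.
have -> : var f = avg (fun w => f w * f w) - avg f * avg f.
  by rewrite /var expr2; congr (_ - _); apply: avg_ext => w; rewrite expr2.
rewrite covariance_interpolation.
apply: ler_wpM2l; [by rewrite invr_ge0|apply: ler_sum => p _].
apply: (@le_trans _ _ (avg (fun w => avg (fun v =>
    2^-1 * (incr f p w v) ^+ 2 + 2^-1 * (path_incr f p w v) ^+ 2)))).
  apply: avg_le => w; apply: avg_le => v.
  have := sqr_ge0 (incr f p w v - path_incr f p w v); rewrite sqrrB; lra.
have -> : avg (fun w => avg (fun v =>
    2^-1 * (incr f p w v) ^+ 2 + 2^-1 * (path_incr f p w v) ^+ 2)) =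
  2^-1 * avg (fun w => avg (fun v => incr f p w v ^+ 2)) +
  2^-1 * avg (fun w => avg (fun v => path_incr f p w v ^+ 2)).
  by rewrite -!avgZ -avgD; apply: avg_ext => w; rewrite -!avgZ -avgD.
rewrite (avg_path_incr (fun x => x ^+ 2)); lra.
Qed.

(** The covariance formula with [g = f], averaged over [v] only; hence its mean is the variance of
    [f]. *)
Definition stein_kernel f w :=
  2^-1 * \sum_p avg (fun v => incr f p w v * path_incr f p w v).

Lemma avg_stein_kernel f : avg (stein_kernel f) = var f.
Proof.
rewrite /stein_kernel avgZ avg_sum -covariance_interpolation /var expr2.
by congr (_ - _); apply: avg_ext => w; rewrite expr2.
Qed.

(** The covariance formula for [F (Y w)] and [f]. [G] acts as the derivative of [F]: the first-order
    part of each increment of [F (Y w)] reproduces [stein_kernel], and the remainder [rem] leaves a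
    term cubic in the increments of [f]. *)
Lemma stein_discrepancy f (Y : Om -> R) (F G : R -> R) (K s : R) :
  0 < s -> s ^+ 2 = var f ->
  (forall x, `|G x| <= K) ->
  (forall x y, `|F y - F x - G x * (y - x)| <= K * (y - x) ^+ 2) ->
  (forall w, Y w = (f w - avg f) / s) ->
  `|avg (fun w => Y w * F (Y w) - G (Y w))| <=
    K / s ^+ 2 * avg (fun w => `|stein_kernel f w - var f|) +
    K / s ^+ 3 * (2^-1 * \sum_p avg (fun w => avg (fun v =>
       incr f p w v ^+ 2 * `|path_incr f p w v|))).
Proof.
move=> s0 s2 GK FK YE; have sn0 : s != 0 by rewrite gt_eqF.
have K0 : 0 <= K := le_trans (normr_ge0 _) (GK 0).
pose rem p w v := F (Y (mix (pred1 p) w v)) - F (Y w) -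
  G (Y w) * (Y (mix (pred1 p) w v) - Y w).
have eYF : avg (fun w => Y w * F (Y w)) =
    s^-1 * (avg (fun w => F (Y w) * f w) - avg (fun w => F (Y w)) * avg f).
  rewrite -avgZr -avgB -avgZ; apply: avg_ext => w; rewrite YE; ring.
have -> : avg (fun w => Y w * F (Y w) - G (Y w)) =
    avg (fun w => G (Y w) * (stein_kernel f w - var f) / s ^+ 2) -
    s^-1 * (2^-1 * \sum_p avg (fun w => avg (fun v => rem p w v * path_incr f p w v))).
  rewrite avgB eYF covariance_interpolation.
  have -> : \sum_p avg (fun w => avg (fun v =>
      incr (fun w => F (Y w)) p w v * path_incr f p w v)) =
     avg (fun w => G (Y w) / s * (2 * stein_kernel f w)) -
     \sum_p avg (fun w => avg (fun v => rem p w v * path_incr f p w v)).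
    rewrite -avg_sum -avg_sum -avgB; apply: avg_ext => w.
    rewrite /stein_kernel mulrA divff ?pnatr_eq0// mul1r mulr_sumr -sumrB.
    apply: eq_bigr => p _; rewrite -avgZ -avgB; apply: avg_ext => v.
    by rewrite /incr /rem !YE; field.
  have -> : avg (fun w => G (Y w) * (stein_kernel f w - var f) / s ^+ 2) =
    s^-1 * (2^-1 * avg (fun w => G (Y w) / s * (2 * stein_kernel f w))) -
    avg (fun w => G (Y w)).
    rewrite -!avgZ -avgB; apply: avg_ext => w; rewrite -s2.
    by field.
  by ring.
rewrite (le_trans (ler_normB _ _))// lerD//.
  rewrite (le_trans (avg_norm _))// -avgZ; apply: avg_le => w.
  rewrite !normrM normfV (ger0_norm (exprn_ge0 _ (ltW s0))) mulrAC.
  rewrite -!mulrA ler_pM ?mulr_ge0 ?invr_ge0 ?sqr_ge0//.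
have -> : K / s ^+ 3 = s^-1 * (K / s ^+ 2) by field.
rewrite normrM (gtr0_norm (_ : 0 < s^-1)) ?invr_gt0// -mulrA ler_wpM2l ?invr_ge0 ?(ltW s0)//.
rewrite normrM (gtr0_norm (_ : 0 < 2^-1)) ?invr_gt0// mulrCA ler_wpM2l ?invr_ge0//.
rewrite (le_trans (ler_norm_sum _ _ _))// mulr_sumr ler_sum// => p _.
rewrite (le_trans (avg_norm _))// -avgZ; apply: avg_le => w.
rewrite (le_trans (avg_norm _))// -avgZ; apply: avg_le => v.
rewrite normrM mulrA ler_wpM2r// (le_trans (FK _ _))//.
have -> : Y (mix (pred1 p) w v) - Y w = - (incr f p w v / s).
  by rewrite !YE /incr; field.
by rewrite sqrrN expr_div_n mulrA mulrAC.
Qed.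

End product_space.

(** * Stars as edge sets *)

(** Edges through a common vertex, no two of them parallel. [ends] is a parameter because the same
    set [B] of edge names is tested in several realisations of the graph. *)
Definition star_set (l : nat) (E V : finType) (ends : E -> {set V}) (B : {set E}) :=
  [&& #|B| == l, [exists v, [forall e in B, v \in ends e]] &
   [forall e in B, [forall e' in B, (ends e == ends e') ==> (e == e')]]].

Lemma star_setP (l : nat) (E V : finType) (ends : E -> {set V}) (B : {set E}) :
  reflect [/\ #|B| = l, exists v, {in B, forall e, v \in ends e} & {in B &, injective ends}]
    (star_set l ends B).
Proof.
apply: (iffP and3P) => -[].
  move=> /eqP Bl /existsP[v /forall_inP vB] /forall_inP Binj; split=> //.
    by exists v.
  move=> e e' eB e'B ee'; apply/eqP.
  by have /forall_inP/(_ _ e'B) := Binj e eB; rewrite ee' eqxx.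
move=> Bl [v vB] Binj; split; first exact/eqP.
  by apply/existsP; exists v; apply/forall_inP.
apply/forall_inP => e eB; apply/forall_inP => e' e'B.
by apply/implyP => /eqP ee'; apply/eqP/Binj.
Qed.

Section star_copies.
Variables (G : multigraph) (l : nat).
Hypothesis l_gt0 : (0 < l)%N.

Lemma imset_star_endpoints (T : finType) (f : 'I_l.+1 -> T) (i : 'I_l) :
  f @: star_endpoints i = [set f ord0; f (lift ord0 i)].
Proof. by rewrite /star_endpoints imsetU1 imset_set1. Qed.

Lemma copiesP (S : {set vertex G} * {set edge G}) :
  reflect (exists (f : {ffun 'I_l.+1 -> vertex G}) (g : {ffun 'I_l -> edge G}),
     [/\ injective f, f @: setT = S.1, injective g, g @: setT = S.2 &
       forall i, endpoints (g i) = [set f ord0; f (lift ord0 i)]])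
    (S \in copies (star l) G).
Proof.
rewrite inE; apply: (iffP andP).
  move=> [_ /existsP[f /existsP[g /and5P[fi /eqP f1 gi /eqP g2 /forallP fg]]]].
  exists f, g; split => //; try exact/injectiveP.
  by move=> i; rewrite (eqP (fg i)) imset_star_endpoints.
move=> [f [g [fi f1 gi g2 fg]]]; split.
  apply/forall_inP => e; rewrite -g2 => /imsetP[i _ ->].
  by rewrite fg -f1 subUset !sub1set !imset_f ?inE.
apply/existsP; exists f; apply/existsP; exists g; apply/and5P; split.
- exact/injectiveP.
- exact/eqP.
- exact/injectiveP.
- exact/eqP.
- by apply/forallP => i; apply/eqP; rewrite fg imset_star_endpoints.
Qed.

(** With at least one edge the centre also lies on an edge, so the edge set determines the copy and
    copies can be counted as edge sets. *)
Lemma copies_vertices S : S \in copies (star l) G ->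
  S.1 = \bigcup_(e in S.2) endpoints e.
Proof.
move=> /copiesP[f [g [fi <- gi <- fg]]].
apply/setP => v; apply/imsetP/bigcupP.
  move=> [i _ ->]; case: (unliftP ord0 i) => [j ->|->].
    by exists (g j); rewrite ?imset_f// fg !inE eqxx orbT.
  exists (g (Ordinal l_gt0)); first by rewrite imset_f.
  by rewrite fg !inE eqxx.
by move=> [_ /imsetP[i _ ->]]; rewrite fg !inE => /orP[] /eqP ->; eexists.
Qed.

Lemma imset_snd_copies :
  snd @: copies (star l) G = [set B | star_set l (@endpoints G) B].
Proof.
apply/setP => B; rewrite inE; apply/imsetP/star_setP.
  move=> [[A B'] /copiesP[f [g [fi /= f1 gi g2 fg]]] ->] /=; rewrite -g2; split.
  - by rewrite card_imset// cardsT card_ord.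
  - by exists (f ord0) => _ /imsetP[i _ ->]; rewrite fg !inE eqxx.
  - move=> _ _ /imsetP[i _ ->] /imsetP[j _ ->]; rewrite !fg => ij.
    have : f (lift ord0 i) \in [set f ord0; f (lift ord0 j)].
      by rewrite -ij !inE eqxx orbT.
    rewrite !inE !(inj_eq fi) => /orP[/eqP//|/eqP/lift_inj->//].
move=> [Bl [v vB] Binj].
have e0 : edge G.
  by move: l_gt0; rewrite -Bl card_gt0 => /set0Pn/sigW[e _].
pose g : {ffun 'I_l -> edge G} := [ffun i : 'I_l => nth e0 (enum B) i].
have gB i : g i \in B.
  by rewrite ffunE -mem_enum mem_nth// -cardE Bl.
have gi : injective g.
  move=> i j /eqP; rewrite !ffunE nth_uniq ?enum_uniq -?cardE ?Bl//.
  by move=> /eqP/val_inj.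
have g2 : g @: setT = B.
  apply/eqP; rewrite eqEcard card_imset// cardsT card_ord Bl leqnn andbT.
  by apply/subsetP => _ /imsetP[i _ ->].
(* The end of [g i] other than the centre [v]; these leaves are distinct because no two edges of [B]
   are parallel. *)
have other i : {u | (u != v) && (endpoints (g i) == [set v; u])}.
  apply: sigW; have /eqP/cards2P[x [y [xy exy]]] := endpoints_card (g i).
  have := vB _ (gB i); rewrite exy !inE => /orP[/eqP->|/eqP->].
    by exists y; rewrite eq_sym xy eqxx.
  by exists x; rewrite xy setUC eqxx.
pose f : {ffun 'I_l.+1 -> vertex G} :=
  [ffun i => if unlift ord0 i is Some j then sval (other j) else v].
have f0 : f ord0 = v by rewrite ffunE unlift_none.
have fl j : f (lift ord0 j) = sval (other j) by rewrite ffunE liftK.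
have fg i : endpoints (g i) = [set f ord0; f (lift ord0 i)].
  by rewrite f0 fl; case: (other i) => u /= /andP[_ /eqP].
exists (f @: setT, B) => //; apply/copiesP; exists f, g; split=> //.
have fv i : f (lift ord0 i) != v by rewrite fl; case: (other i) => u /= /andP[].
move=> i j; case: (unliftP ord0 i) => [i' ->|->];
  case: (unliftP ord0 j) => [j' ->|->] //.
- by move=> ij; congr (lift _ _); apply: gi; apply: Binj => //; rewrite !fg ij.
- by move=> ij; have := fv i'; rewrite ij f0 eqxx.
- by move=> ij; have := fv j'; rewrite -ij f0 eqxx.
Qed.

Lemma card_copies_star :
  #|copies (star l) G| = #|[set B | star_set l (@endpoints G) B]|.
Proof.
rewrite -imset_snd_copies card_in_imset// => S S' hS hS' SS'.
have h := copies_vertices hS; rewrite SS' -(copies_vertices hS') in h.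
by case: S S' h SS' {hS hS'} => [A B] [A' B'] /= -> ->.
Qed.

End star_copies.

Lemma bin_le_exp n k : ('C(n, k) <= n ^ k)%N.
Proof.
rewrite (@leq_trans (n ^_ k))//; first by rewrite -bin_ffact leq_pmulr ?fact_gt0.
elim: k => [|k IHk] //.
by rewrite ffactnSr expnSr leq_mul// leq_subr.
Qed.

Lemma expn_sum_le (J : finType) (A : {set J}) (x : J -> nat) k : (0 < k)%N ->
  ((\sum_(j in A) x j) ^ k <= #|A| ^ k * \sum_(j in A) x j ^ k)%N.
Proof.
move=> k0; have [->|[j0 j0A]] := set_0Vmem A.
  by rewrite big_set0 exp0n.
have [j jA hj] : exists2 j, j \in A & forall i, i \in A -> (x i <= x j)%N.
  by case: (arg_maxnP x j0A) => j jA hj; exists j.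
apply: (@leq_trans ((#|A| * x j) ^ k)%N).
  by rewrite leq_exp2r// -sum_nat_const leq_sum.
by rewrite expnMn leq_mul2l (bigD1 j)//= leq_addr orbT.
Qed.

(** * Edge neighbourhoods in a common envelope *)

Section envelope.
Local Open Scope nat_scope.
Variables (I V : finType) (U : I -> {set V}).

(** [U p] stands for a set containing the ends of edge [p] in every realisation considered; only
    edges adjacent in this sense can share a star. *)
Definition adjacent (p r : I) := U p :&: U r != set0.
Definition nbr (p : I) := #|[set r | adjacent p r]|.

Lemma adjacent_sym p r : adjacent p r = adjacent r p.
Proof. by rewrite /adjacent setIC. Qed.

(** A neighbour of [p] contains one of the at most [c] vertices of [U p], so [nbr p] is at most the
    sum of their degrees. Summing over [p] counts the power of the degree of [v] once per edge at
    [v], hence the exponent [k.+1]. *)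
Lemma sum_nbr_exp c k : (0 < k)%N -> (forall p, #|U p| <= c)%N ->
  (\sum_p nbr p ^ k <= c ^ k * \sum_v #|[set r | v \in U r]| ^ k.+1)%N.
Proof.
move=> k0 Uc; pose D v := #|[set r | v \in U r]|.
have ND p : (nbr p <= \sum_(v in U p) D v)%N.
  rewrite /nbr -sum1dep_card /D.
  under [X in (_ <= X)%N]eq_bigr do rewrite -sum1dep_card big_mkcond.
  rewrite exchange_big big_mkcond /=; apply: leq_sum => r _.
  case: ifP => // /set0Pn[v /[!inE] /andP[vp vr]].
  by rewrite (bigD1 v)//= vr.
apply: (@leq_trans (\sum_p c ^ k * \sum_(v in U p) D v ^ k)).
  apply: leq_sum => p _; apply: (@leq_trans ((\sum_(v in U p) D v) ^ k)).
    by rewrite leq_exp2r.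
  by rewrite (leq_trans (expn_sum_le _ _ k0))// leq_mul// leq_exp2r.
rewrite -big_distrr leq_mul2l /=; apply/orP; right.
under eq_bigr do rewrite big_mkcond.
rewrite exchange_big; apply: leq_sum => v _ /=.
rewrite -big_mkcond sum_nat_cond_const expnS; exact: leqnn.
Qed.

(** From [a * b ^ k <= a ^ k.+1 + b ^ k.+1]; summing over adjacent pairs adds one more factor [nbr]
    to each term, to the second one by symmetry. *)
Lemma sum_nbr_adjacent k :
  (\sum_i nbr i * \sum_(j | adjacent i j) nbr j ^ k <= 2 * \sum_i nbr i ^ k.+2)%N.
Proof.
have h a b : (a * b ^ k <= a ^ k.+1 + b ^ k.+1)%N.
  have [ab|/ltnW ba] := leqP a b.
    by rewrite -[X in (X <= _)%N]add0n leq_add// expnS leq_mul2r ab orbT.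
  rewrite -[X in (X <= _)%N]addn0 leq_add// expnS leq_mul2l.
  by case: (k) => [|k']; rewrite ?leqnn ?orbT// leq_exp2r// ba orbT.
apply: (@leq_trans (\sum_i \sum_(j | adjacent i j) (nbr i ^ k.+1 + nbr j ^ k.+1))).
  by apply: leq_sum => i _; rewrite big_distrr; apply: leq_sum => j _; exact: h.
under eq_bigr do rewrite big_split /=.
rewrite big_split /= mul2n -addnn; apply: leq_add.
  by apply: leq_sum => i _; rewrite sum_nat_cond_const [leqRHS]expnS; exact: leqnn.
under eq_bigr do rewrite big_mkcond.
rewrite exchange_big; apply: leq_sum => j _ /=; rewrite -big_mkcond.
rewrite sum_nat_cond_const [leqRHS]expnS leq_mul2r; apply/orP; right.
by apply: subset_leq_card; apply/subsetP => i; rewrite !inE adjacent_sym.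
Qed.

End envelope.

(** * Effect on the star count of changing one or two edges *)

Section star_count.
Variables (R : realFieldType) (I V : finType) (l : nat).
Implicit Types (ends : I -> {set V}) (B : {set I}).

Definition star_count ends : R := #|[set B | star_set l ends B]|%:R.

Lemma star_countE ends :
  star_count ends = \sum_(B : {set I}) (star_set l ends B)%:R.
Proof.
rewrite /star_count -sum1dep_card natr_sum big_mkcond.
by apply: eq_bigr => B _; case: ifP.
Qed.

Lemma star_set_eq ends ends' B : {in B, ends =1 ends'} ->
  star_set l ends B = star_set l ends' B.
Proof.
move=> ee; apply/star_setP/star_setP => -[Bl [v vB] Binj]; split=> //.
- by exists v => e eB; rewrite -ee ?vB.
- by move=> e e' eB e'B; rewrite -!ee//; exact: Binj.
- by exists v => e eB; rewrite ee ?vB.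
- by move=> e e' eB e'B; rewrite !ee//; exact: Binj.
Qed.

Variable U : I -> {set V}.

Definition dominated ends := forall p, ends p \subset U p.

Lemma star_set_adjacent ends B p r : dominated ends -> star_set l ends B ->
  p \in B -> r \in B -> adjacent U p r.
Proof.
move=> dU /star_setP[_ [v vB] _] pB rB; apply/set0Pn; exists v.
by rewrite inE (subsetP (dU p) _ (vB _ pB)) (subsetP (dU r) _ (vB _ rB)).
Qed.

(** Candidates for the stars through [p]; they depend on [U] alone and so serve all realisations
    dominated by [U] at once. *)
Definition star_cand p B := (B \subset [set r | adjacent U p r]) && (#|B| == l).

Lemma star_set_cand ends B p : dominated ends -> p \in B ->
  (star_set l ends B)%:R <= (star_cand p B)%:R :> R.
Proof.
move=> dU pB; case: (boolP (star_set _ _ _)) => // sB; rewrite ler_nat lt0b.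
apply/andP; split; last by case/star_setP: sB => ->.
by apply/subsetP => r rB; rewrite inE (star_set_adjacent dU sB).
Qed.

Lemma sum_star_cand p : \sum_B (star_cand p B)%:R <= (nbr U p ^ l)%:R :> R.
Proof.
rewrite -natr_sum ler_nat (leq_trans _ (bin_le_exp _ _))// -cards_draws.
rewrite -sum1_card [leqRHS]big_mkcond leq_sum// => B _.
by rewrite inE /star_cand; case: ifP.
Qed.

Lemma star_count_at ends p : dominated ends ->
  \sum_(B : {set I} | p \in B) (star_set l ends B)%:R <= (nbr U p ^ l)%:R :> R.
Proof.
move=> dU; apply: le_trans (sum_star_cand p).
rewrite big_mkcond ler_sum// => B _; case: ifP => // pB.
exact: star_set_cand.
Qed.

(** Only sets containing [p] can change status, each changes the count by at most one, and those
    that are ever stars are candidates at [p]. *)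
Lemma star_count_diff ends ends' p : dominated ends -> dominated ends' ->
  (forall r, r != p -> ends r = ends' r) ->
  `|star_count ends - star_count ends'| <= (nbr U p ^ l)%:R.
Proof.
move=> dU dU' ee; rewrite !star_countE -sumrB (le_trans (ler_norm_sum _ _ _))//.
apply: le_trans (sum_star_cand p); apply: ler_sum => B _.
have [pB|pB] := boolP (p \in B); last first.
  rewrite (@star_set_eq ends ends') ?subrr ?normr0// => r rB.
  by apply: ee; apply: contraNneq pB => <-.
have := star_set_cand dU pB; have := star_set_cand dU' pB.
do 2 case: (star_set _ _ _); rewrite ?subrr ?subr0 ?sub0r ?normrN ?normr0 ?normr1//.
Qed.

(** In this mixed second difference every set missing [i] or [j] cancels. A star containing both
    forces [i] and [j] to be adjacent, and each such set contributes at most two. *)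
Lemma star_count_diff2 ends1 ends2 ends3 ends4 i j :
  dominated ends1 -> dominated ends2 -> dominated ends3 -> dominated ends4 ->
  (forall r, r != j -> ends1 r = ends2 r) ->
  (forall r, r != j -> ends3 r = ends4 r) ->
  (forall r, r != i -> ends1 r = ends3 r) ->
  (forall r, r != i -> ends2 r = ends4 r) ->
  `|star_count ends1 - star_count ends2 - (star_count ends3 - star_count ends4)|
    <= (adjacent U i j)%:R * (2 * (nbr U j ^ l)%:R).
Proof.
move=> d1 d2 d3 d4 e12 e34 e13 e24.
rewrite !star_countE -!sumrB (le_trans (ler_norm_sum _ _ _))//.
have := sum_star_cand j.
rewrite -(ler_pM2l (ltr0Sn R 1)) => hS.
apply: le_trans (ler_wpM2l (ler0n _ _) hS).
rewrite !mulr_sumr ler_sum// => B _.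
have [jB|jB] := boolP (j \in B); last first.
  have ne r : r \in B -> r != j by move=> rB; apply: contraNneq jB => <-.
  rewrite (@star_set_eq ends1 ends2); last by move=> r /ne/e12.
  rewrite (@star_set_eq ends3 ends4); last by move=> r /ne/e34.
  by rewrite !subrr normr0 !mulr_ge0.
have [iB|iB] := boolP (i \in B); last first.
  have ne r : r \in B -> r != i by move=> rB; apply: contraNneq iB => <-.
  rewrite (@star_set_eq ends1 ends3); last by move=> r /ne/e13.
  rewrite (@star_set_eq ends2 ends4); last by move=> r /ne/e24.
  by rewrite subrr normr0 !mulr_ge0.
have c1 := star_set_cand d1 jB; have c2 := star_set_cand d2 jB.
have c3 := star_set_cand d3 jB; have c4 := star_set_cand d4 jB.
have [nij|nij] := boolP (adjacent U i j); last first.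
  have F e : dominated e -> star_set l e B = false.
    by move=> de; apply: contraNF nij => sB; exact: star_set_adjacent sB iB jB.
  by rewrite !F// !subrr normr0 !mulr_ge0.
rewrite mul1r (le_trans (ler_normB _ _))// mulr_natl mulr2n.
apply: lerD; rewrite ler_norml; move: c1 c2 c3 c4;
 do 4 case: (star_set _ _ _); rewrite ?mulr0n ?mulr1n; lra.
Qed.

End star_count.

Lemma sqr_sum_le (R : realFieldType) (J : finType) (P : pred J) (x : J -> R) :
  (\sum_(j | P j) x j) ^+ 2 <= #|[set j | P j]|%:R * \sum_(j | P j) x j ^+ 2.
Proof.
rewrite expr2 mulr_suml.
apply: (@le_trans _ _ (\sum_(i | P i) \sum_(j | P j) 2^-1 * (x i ^+ 2 + x j ^+ 2))).
  apply: ler_sum => i _; rewrite mulr_sumr; apply: ler_sum => j _.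
  have := sqr_ge0 (x i - x j); rewrite sqrrB; lra.
under eq_bigr do rewrite -mulr_sumr big_split /= sumr_const.
rewrite -mulr_sumr big_split /= sumr_const sumrMnl cardsE -mulr_natl; lra.
Qed.

(** * Moment bounds for the derivatives of the star count *)

Section star_moments.
Variables (R : realFieldType) (I V : finType) (T : I -> finType) (l : nat).
Variable q : forall p, T p -> R.
Arguments q : clear implicits.
Hypothesis q_ge0 : forall p x, 0 <= q p x.
Hypothesis q_sum1 : forall p, \sum_x q p x = 1.
Variable inc : forall p, T p -> {set V}.
Arguments inc : clear implicits.

Notation Om := {dffun forall p : I, T p}.
Implicit Types (w u v : Om) (A : pred I).
Local Notation avg := (avg q).

Definition ends w p := inc p (w p).
Definition stars w : R := star_count R l (ends w).
(* [u] provides the resampled coordinate in the Efron-Stein inequality, [v] the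
   end point of the interpolation in [stein_kernel]. *)
Definition env w u v p := ends w p :|: ends u p :|: ends v p.
Definition moment k :=
  avg (fun w => avg (fun u => avg (fun v => (\sum_p nbr (env w u v) p ^ k)%:R))).

Lemma dom1 w u v : dominated (env w u v) (ends w).
Proof. by move=> p; rewrite /env -setUA subsetUl. Qed.

Lemma dom2 w u v : dominated (env w u v) (ends u).
Proof. by move=> p; rewrite /env setUAC subsetUr. Qed.

Lemma dom3 w u v : dominated (env w u v) (ends v).
Proof. by move=> p; rewrite /env subsetUr. Qed.

Lemma dom_mix U A w v : dominated U (ends w) -> dominated U (ends v) ->
  dominated U (ends (mix A w v)).
Proof. by move=> dw dv p; rewrite /ends mixE; case: (A p); [exact: dv|exact: dw]. Qed.

Lemma incr_stars_le U p w v : dominated U (ends w) -> dominated U (ends v) ->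
  `|incr stars p w v| <= (nbr U p ^ l)%:R.
Proof.
move=> dw dv; apply: star_count_diff => //; first exact: dom_mix.
by move=> r rp; rewrite /ends mixE /= (negbTE rp).
Qed.

Lemma before_upto (r p : I) : r != p -> before p r = upto p r.
Proof.
move=> rp; rewrite /before /upto /= ltn_neqAle.
by rewrite (inj_eq val_inj) (inj_eq enum_rank_inj) rp.
Qed.

Lemma path_incr_stars_le U p w v : dominated U (ends w) -> dominated U (ends v) ->
  `|path_incr stars p w v| <= (nbr U p ^ l)%:R.
Proof.
move=> dw dv; apply: star_count_diff => //; try exact: dom_mix.
by move=> r rp; rewrite /ends !mixE before_upto.
Qed.

Section resample.
Variables (U : I -> {set V}) (i : I) (w u v : Om).
Hypotheses (dw : dominated U (ends w)) (du : dominated U (ends u))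
  (dv : dominated U (ends v)).
Let w' := mix (pred1 i) w u.

Let mix_off A r : r != i -> ends (mix A w v) r = ends (mix A w' v) r.
Proof. by move=> ri; rewrite /ends !mixE /= (negbTE ri). Qed.

Let dw' : dominated U (ends w'). Proof. exact: dom_mix. Qed.

Lemma incr_stars_resample j :
  `|incr stars j w v - incr stars j w' v| <=
  (adjacent U i j)%:R * (2 * (nbr U j ^ l)%:R).
Proof.
apply: star_count_diff2 => //; try (by apply: dom_mix); try exact: mix_off.
- by move=> r rj; rewrite /ends mixE /= (negbTE rj).
- by move=> r rj; rewrite /ends [in RHS]mixE /= (negbTE rj).
- by move=> r ri; rewrite /ends !mixE /= (negbTE ri).
Qed.

Lemma path_incr_stars_resample j :
  `|path_incr stars j w v - path_incr stars j w' v| <=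
  (adjacent U i j)%:R * (2 * (nbr U j ^ l)%:R).
Proof.
apply: star_count_diff2; try (by apply: dom_mix); try exact: mix_off.
- by move=> r rj; rewrite /ends !mixE before_upto.
- by move=> r rj; rewrite /ends !mixE before_upto.
Qed.

(** Product rule: one factor is a second difference, which vanishes unless [i] and [j] are adjacent,
    the other a first difference, at most [nbr U j ^ l]. *)
Lemma kernel_term_resample j :
  `|incr stars j w v * path_incr stars j w v -
    incr stars j w' v * path_incr stars j w' v| <=
  (adjacent U i j)%:R * (4 * (nbr U j ^ (2 * l))%:R).
Proof.
have -> : incr stars j w v * path_incr stars j w v -
    incr stars j w' v * path_incr stars j w' v =
  (incr stars j w v - incr stars j w' v) * path_incr stars j w v +
  incr stars j w' v * (path_incr stars j w v - path_incr stars j w' v) by ring.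
have h1 := incr_stars_resample j; have h2 := path_incr_stars_resample j.
have h3 := path_incr_stars_le j dw dv; have h4 := incr_stars_le j dw' dv.
rewrite (le_trans (ler_normD _ _))// !normrM.
have -> : (adjacent U i j)%:R * (4 * (nbr U j ^ (2 * l))%:R) =
  (adjacent U i j)%:R * (2 * (nbr U j ^ l)%:R) * (nbr U j ^ l)%:R +
  (nbr U j ^ l)%:R * ((adjacent U i j)%:R * (2 * (nbr U j ^ l)%:R)) :> R.
  by rewrite mul2n -addnn expnD natrM; ring.
by apply: lerD; apply: ler_pM.
Qed.

End resample.

(** The square moves inside the average over [v] by Jensen; as only edges [j] adjacent to [i]
    contribute, Cauchy-Schwarz then costs a factor [nbr i]. *)
Lemma stein_kernel_resample i w u :
  (stein_kernel q stars w - stein_kernel q stars (mix (pred1 i) w u)) ^+ 2 <=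
  4 * avg (fun v => (nbr (env w u v) i *
    \sum_(j | adjacent (env w u v) i j) nbr (env w u v) j ^ (4 * l))%:R).
Proof.
set w' := mix _ _ _.
have e4 : 2^-1 ^+ 2 * 16 = 4 :> R by field.
pose S v := \sum_(j | adjacent (env w u v) i j) 4 * (nbr (env w u v) j ^ (2 * l))%:R : R.
have hS : `|stein_kernel q stars w - stein_kernel q stars w'| <= 2^-1 * avg S.
  rewrite /stein_kernel -mulrBr normrM ger0_norm ?invr_ge0//.
  apply: ler_wpM2l; first by rewrite invr_ge0.
  rewrite -sumrB (le_trans (ler_norm_sum _ _ _))//.
  rewrite /S (@avg_ext _ _ _ q _ (fun v => \sum_j (adjacent (env w u v) i j)%:R *
      (4 * (nbr (env w u v) j ^ (2 * l))%:R))); last first.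
    move=> v; rewrite big_mkcond; apply: eq_bigr => j _.
    by case: ifP => _; rewrite ?mul1r ?mul0r.
  rewrite avg_sum; apply: ler_sum => j _.
  rewrite -avgB (le_trans (avg_norm _ _))//; apply: avg_le => // v.
  by apply: kernel_term_resample; [exact: dom1|exact: dom2|exact: dom3].
rewrite -real_normK ?num_real//.
have S0 : 0 <= avg S.
  by apply: avg_ge0 => // v; apply: sumr_ge0 => j _; rewrite mulr_ge0.
apply: (@le_trans _ _ ((2^-1 * avg S) ^+ 2)).
  by rewrite lerXn2r// ?nnegrE// mulr_ge0// invr_ge0.
rewrite exprMn -[X in _ <= X * _]e4 -[leRHS]mulrA; apply: ler_wpM2l; first exact: sqr_ge0.
rewrite (le_trans (avg_sqr_le _ _ _))// -avgZ; apply: avg_le => // v.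
rewrite (le_trans (sqr_sum_le _ _))// natrM mulrCA ler_wpM2l//.
rewrite natr_sum mulr_sumr ler_sum// => j _.
rewrite exprMn -[X in _ * X]natrX -expnM le_eqVlt; apply/orP; left; apply/eqP.
by congr (_ * _%:R); [ring|congr (_ ^ _)%N; lia].
Qed.

(** Efron-Stein for the kernel itself. The factor [nbr i] and the sum over adjacent [j] raise the
    exponent [4 * l] by two. *)
Lemma var_stein_kernel_le : var q (stein_kernel q stars) <= 4 * moment (4 * l).+2.
Proof.
apply: le_trans (efron_stein q_ge0 q_sum1 _) _.
have -> : 4 * moment (4 * l).+2 = 2^-1 * (8 * moment (4 * l).+2) by field.
apply: ler_wpM2l; first by rewrite invr_ge0.
rewrite -avg_sum /moment -avgZ; apply: avg_le => // w.
rewrite -avg_sum -avgZ; apply: avg_le => // u.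
apply: (@le_trans _ _ (\sum_i 4 * avg (fun v => (nbr (env w u v) i *
    \sum_(j | adjacent (env w u v) i j) nbr (env w u v) j ^ (4 * l))%:R))).
  by apply: ler_sum => i _; exact: stein_kernel_resample.
rewrite -mulr_sumr -avg_sum -!avgZ; apply: avg_le => // v.
have -> : 8 * (\sum_p nbr (env w u v) p ^ (4 * l).+2)%:R =
  4 * (2 * \sum_p nbr (env w u v) p ^ (4 * l).+2)%:R :> R by rewrite natrM; ring.
by rewrite ler_wpM2l// -natr_sum ler_nat sum_nbr_adjacent.
Qed.

Lemma var_stars_le : var q stars <= moment (2 * l).
Proof.
apply: le_trans (efron_stein q_ge0 q_sum1 _) _.
rewrite -[leRHS]mul1r; apply: ler_pM => //; first by rewrite invr_ge0.
- by apply: sumr_ge0 => p _; do 2 (apply: avg_ge0 => // ?); exact: sqr_ge0.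
- by lra.
rewrite -avg_sum; apply: avg_le => // w.
rewrite -avg_sum; apply: avg_le => // u.
rewrite -[leLHS](avg_cst q_sum1); apply: avg_le => // v.
rewrite natr_sum; apply: ler_sum => p _.
rewrite -real_normK ?num_real// mulnC expnM natrX lerXn2r ?nnegrE//.
by apply: incr_stars_le; [exact: dom1|exact: dom2].
Qed.

Lemma cubic_stars_le :
  \sum_p avg (fun w => avg (fun u => incr stars p w u ^+ 2 * `|path_incr stars p w u|))
  <= moment (3 * l).
Proof.
rewrite -avg_sum; apply: avg_le => // w.
rewrite -avg_sum; apply: avg_le => // u.
rewrite -[leLHS](avg_cst q_sum1); apply: avg_le => // v.
rewrite natr_sum; apply: ler_sum => p _.
have -> : (3 * l = l * 2 + l)%N by lia.
rewrite expnD expnM natrM natrX -real_normK ?num_real//.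
apply: ler_pM; rewrite ?sqr_ge0//.
  rewrite lerXn2r ?nnegrE//.
  by apply: incr_stars_le; [exact: dom1|exact: dom2].
by apply: path_incr_stars_le; [exact: dom1|exact: dom2].
Qed.

Definition stars_at w p : R := \sum_(B : {set I} | p \in B) (star_set l (ends w) B)%:R.

Lemma sum_stars_at_le : \sum_p avg (fun w => stars_at w p) <= moment l.
Proof.
rewrite -avg_sum; apply: avg_le => // w.
rewrite -[leLHS](avg_cst q_sum1); apply: avg_le => // u.
rewrite -[leLHS](avg_cst q_sum1); apply: avg_le => // v.
rewrite natr_sum; apply: ler_sum => p _.
by apply: star_count_at; exact: dom1.
Qed.

Definition degree w x := #|[set p | x \in ends w p]|.

(** The degree of [x] in [env] is at most the sum of its degrees in three realisations, whence the
    power of 3; an envelope has at most 6 vertices, whence the power of 6; the last factor 3 counts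
    the identically distributed realisations. *)
Lemma moment_le k (M : R) : (0 < k)%N -> (forall p x, (#|inc p x| <= 2)%N) ->
  avg (fun w => (\sum_x degree w x ^ k.+1)%:R) <= M ->
  moment k <= (6 ^ k * 3 ^ k.+1)%:R * (3 * M).
Proof.
move=> k0 inc2 hM.
have dg w u v x : (#|[set p | x \in env w u v p]| ^ k.+1 <=
    3 ^ k.+1 * (degree w x ^ k.+1 + degree u x ^ k.+1 + degree v x ^ k.+1))%N.
  pose d (t : 'I_3) := nth 0%N [:: degree w x; degree u x; degree v x] t.
  have := @expn_sum_le _ [set: 'I_3] d k.+1 (ltn0Sn k).
  rewrite cardsT card_ord; under eq_bigl do rewrite inE.
  under [in X in (_ <= X)%N -> _]eq_bigl do rewrite inE.
  rewrite !big_ord_recl !big_ord0 /= !addn0 !addnA; apply: leq_trans.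
  rewrite leq_exp2r//.
  have -> : [set p | x \in env w u v p] =
      [set p | x \in ends w p] :|: [set p | x \in ends u p] :|: [set p | x \in ends v p].
    by apply/setP => p; rewrite !inE.
  by rewrite (leq_trans (leq_card_setU _ _))// leq_add2r leq_card_setU.
have card6 w u v p : (#|env w u v p| <= 6)%N.
  apply: leq_trans (leq_card_setU _ _) _.
  apply: (@leq_add _ _ 4 2); last exact: inc2.
  by apply: leq_trans (leq_card_setU _ _) _; apply: (@leq_add _ _ 2 2); exact: inc2.
set D := fun w => (\sum_x degree w x ^ k.+1)%:R : R in hM.
apply: (@le_trans _ _ ((6 ^ k * 3 ^ k.+1)%:R *
   avg (fun w => avg (fun u => avg (fun v => D w + D u + D v))))).
  rewrite /moment -!avgZ; apply: avg_le => // w; rewrite -!avgZ; apply: avg_le => // u.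
  rewrite -!avgZ; apply: avg_le => // v.
  rewrite /D -!natrD -natrM ler_nat.
  rewrite (leq_trans (sum_nbr_exp k0 (card6 w u v)))// -mulnA leq_mul2l.
  apply/orP; right; rewrite -!big_split big_distrr /=; apply: leq_sum => x _.
  exact: dg.
apply: ler_wpM2l => //.
have -> : avg (fun w => avg (fun u => avg (fun v => D w + D u + D v))) = 3 * avg D.
  under (@avg_ext _ _ _ q) => w.
    under (@avg_ext _ _ _ q) => u do rewrite avgD (avg_cst q_sum1).
    rewrite avgD avgD !(avg_cst q_sum1); over.
  by rewrite !avgD !(avg_cst q_sum1); ring.
by rewrite ler_wpM2l.
Qed.

End star_moments.

(** * Degrees in the uniform attachment graph *)

(** A converse of Bernoulli's inequality for small [k * s]: in the induction the product
    [2 * k%:R * s * s] is absorbed by [s]. *)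
Lemma bernoulli_upper (R : realFieldType) (s : R) k :
  0 <= s -> 2 * k%:R * s <= 1 -> (1 + s) ^+ k <= 1 + 2 * k%:R * s.
Proof.
move=> s0; elim: k => [|k IHk] ks; first by rewrite mulr0 mul0r addr0.
have ks' : 2 * k%:R * s <= 1.
  by apply: le_trans ks; rewrite ler_wpM2r// ler_wpM2l// ler_nat.
rewrite exprS (le_trans (ler_wpM2l _ (IHk ks'))) ?addr_ge0//.
have : 2 * k%:R * s * s <= s by rewrite ler_piMl.
by rewrite -natr1; lra.
Qed.

Lemma exp_dominates_power (R : realFieldType) (t : R) k : 0 < t -> t <= 1 ->
  exists C, 0 < C /\ forall d : nat, d%:R ^+ k <= C * (1 + t) ^+ d.
Proof.
(* [s] is so small that [(1 + s) ^+ k <= 1 + t]; with Bernoulli, [(s * d) ^+ k <= (1 + s) ^+ (k * d)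
   <= (1 + t) ^+ d]. *)
move=> t0 t1; pose s := t / (2 * k.+1%:R).
have k0 : 0 < 2 * k.+1%:R :> R by rewrite mulr_gt0.
have s0 : 0 < s by rewrite divr_gt0.
exists (s ^- k); split; first by rewrite invr_gt0 exprn_gt0.
move=> d; rewrite ler_pdivlMl ?exprn_gt0// -exprMn.
have st : (1 + s) ^+ k.+1 <= 1 + t.
  have e : 2 * k.+1%:R * s = t by rewrite /s mulrCA divff ?mulr1// gt_eqF.
  by rewrite -e; apply: bernoulli_upper; rewrite ?e// ltW.
have st' : (1 + s) ^+ k <= 1 + t.
  by apply: le_trans st; rewrite ler_weXn2l ?lerDl ?(ltW s0).
have s1 : 0 <= 1 + s by rewrite addr_ge0// ltW.
apply: (@le_trans _ _ ((1 + s) ^+ (k * d))); last first.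
  by rewrite exprM lerXn2r// ?nnegrE ?exprn_ge0 ?addr_ge0 ?(ltW s0) ?(ltW t0).
rewrite mulnC exprM lerXn2r ?nnegrE ?(mulr_ge0 (ltW s0) (ler0n _ _)) ?exprn_ge0 ?s1//.
elim: d => [|d IHd]; first by rewrite mulr0.
rewrite exprS mulrDl mul1r -natr1 mulrDr mulr1 lerD// ler_peMr ?(ltW s0)//.
by rewrite exprn_ege1// lerDl ltW.
Qed.

(* [h x j] stands for the factor that the edges sent by vertex [j + 1] contribute
   to the exponential moment of the degree of [x]. *)
Lemma sum_growth_prod (R : realFieldType) (N : nat) (h : nat -> nat -> R) :
  (forall x j, 0 <= h x j) ->
  (forall x j, (x <= j)%N -> h x j <= 1 + 2^-1 / j.+1%:R) ->
  (forall j, h j.+1 j <= 2) ->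
  (forall x j, (j.+1 < x)%N -> h x j <= 1) ->
  \sum_(x < N.+1) \prod_(j < N) h x j <= 4 * N.+1%:R.
Proof.
move=> h0 h1 h2 h3; elim: N => [|N IHN].
  by rewrite big_ord1 big_ord0 mulr1; lra.
rewrite big_ord_recr /=.
have a2 : \prod_(j < N.+1) h N.+1 j <= 2.
  rewrite big_ord_recr /= -[leRHS]mul1r ler_pM ?prodr_ge0//.
  by apply: prodr_ile1 => j _; rewrite h0 h3// ltnS ltn_ord.
(* Each older vertex gains a factor at most [1 + 2^-1 / N.+1%:R], which adds at most 2 to
   [4 * N.+1%:R]; with the at most 2 of the new vertex this is the allowed increment 4. *)
have a1 : \sum_(x < N.+1) \prod_(j < N.+1) h x j <= 4 * N.+1%:R + 2.
  apply: (@le_trans _ _ (\sum_(x < N.+1) (\prod_(j < N) h x j) * (1 + 2^-1 / N.+1%:R))).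
    apply: ler_sum => x _; rewrite big_ord_recr /= ler_wpM2l ?prodr_ge0//.
    by rewrite h1// -ltnS.
  rewrite -mulr_suml.
  have N0 : (0:R) < N.+1%:R by rewrite ltr0n.
  apply: (le_trans (ler_wpM2r _ IHN)); first by rewrite addr_ge0 ?divr_ge0 ?invr_ge0.
  move: (N.+1%:R) N0 => y y0.
  have -> : 4 * y * (1 + 2^-1 / y) = 4 * y + 2 by field; rewrite gt_eqF.
  exact: lexx.
by rewrite -[N.+2%:R]natr1; lra.
Qed.

Section uniform_attachment.
Variables (R : realFieldType) (m n : nat).
Hypothesis m_gt0 : (0 < m)%N.
Notation I := ('I_n.-1 * 'I_m)%type.

Definition ua_q (p : I) (x : 'I_p.1.+1) : R := p.1.+1%:R^-1.

Definition ua_inc (p : I) (x : 'I_p.1.+1) : {set 'I_n} :=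
  [set new_vertex p.1; old_vertex x].

Lemma ua_q_ge0 p x : 0 <= @ua_q p x. Proof. by rewrite invr_ge0. Qed.

Lemma ua_q_sum1 p : \sum_x @ua_q p x = 1.
Proof. by rewrite sumr_const card_ord -[LHS]mulr_natl divff// pnatr_eq0. Qed.

Lemma ua_inc_card p x : (#|@ua_inc p x| <= 2)%N.
Proof. by rewrite cards2; case: (_ != _). Qed.

Local Notation avg := (avg ua_q).
Local Notation degree := (degree ua_inc).

(** By independence the average is taken edge by edge: an edge sent by [x] always counts, one sent
    by a later vertex hits [x] with probability [j.+1%:R^-1], one sent by an earlier vertex never
    does. *)
Lemma avg_exp_degree (t : R) (x : 'I_n) : 0 <= t ->
  avg (fun w => (1 + t) ^+ degree w x) =
  \prod_(j < n.-1) (if x == j.+1 :> nat then 1 + t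
     else if (x <= j)%N then 1 + t / j.+1%:R else 1) ^+ m.
Proof.
move=> t0.
have e w : (1 + t) ^+ degree w x =
    \prod_p (if x \in ua_inc (w p) then 1 + t else 1).
  by rewrite /degree -big_mkcond /= prodr_const cardsE.
rewrite (@avg_ext _ _ _ ua_q _ _ e).
rewrite (avg_prod _ (fun p z => if x \in @ua_inc p z then 1 + t else 1)).
rewrite -(pair_bigA _ (fun j a => \sum_z @ua_q (j, a) z *
   (if x \in @ua_inc (j, a) z then 1 + t else 1))) /=.
apply: eq_bigr => j _.
rewrite -[in RHS](card_ord m) -prodr_const; apply: eq_bigr => a _.
rewrite /ua_q /= -mulr_sumr.
have j0 : j.+1%:R != 0 :> R by rewrite pnatr_eq0.
case: eqP => xj.
  have xn : x = new_vertex j by apply: val_inj.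
  rewrite (eq_bigr (fun=> 1 + t)); last by move=> z _; rewrite !inE xn eqxx.
  by rewrite sumr_const card_ord /= -[X in _ * X]mulr_natl mulKf.
case: leqP => hxj.
  have hx : (x < j.+1)%N by [].
  rewrite (bigD1 (Ordinal hx)) //= !inE.
  have -> : x == old_vertex (Ordinal hx) by apply/eqP/val_inj.
  rewrite orbT (eq_bigr (fun=> 1)); last first.
    move=> z zx; rewrite !inE -!val_eqE /=; case: eqP => // _ /=.
    by case: eqP => // xz; move: zx; rewrite -val_eqE /= xz eqxx.
  rewrite sumr_const cardC1 card_ord /= -natr1.
  have jn : (j%:R : R) + 1 != 0 by rewrite natr1 pnatr_eq0.
  by field.
rewrite (eq_bigr (fun=> 1)); last first.
  move=> z _; rewrite !inE -!val_eqE /=; case: eqP => // _ /=.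
  by case: eqP => // xz; move: hxj; rewrite xz ltnNge -ltnS ltn_ord.
by rewrite sumr_const card_ord mulVf// pnatr_eq0.
Qed.

End uniform_attachment.

Lemma ua_degree_moment (R : realFieldType) m k : (0 < m)%N ->
  exists M : R, 0 <= M /\ forall n,
   avg (@ua_q R m n) (fun w => (\sum_x degree (@ua_inc m n) w x ^ k)%:R) <= M * n%:R.
Proof.
(* With [2 * m%:R * t = 2^-1], the [m] edges sent by a later vertex give together a factor at most
   [1 + 2^-1 / j.+1%:R], and the edges sent by [x] itself one at most 2. *)
move=> m0; pose t : R := (4 * m%:R)^-1.
have m4 : 0 < 4 * m%:R :> R by rewrite mulr_gt0// ltr0n.
have t0 : 0 < t by rewrite invr_gt0.
have m1 : m%:R != 0 :> R by rewrite pnatr_eq0 -lt0n.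
have e0 : 2 * m%:R * t = 2^-1 by rewrite /t; field.
have t1 : t <= 1.
  by rewrite invf_le1// -natrM ler1n muln_gt0.
have [C [C0 hC]] := exp_dominates_power k t0 t1.
exists (C * 4); split; first by rewrite mulr_ge0// ltW.
case=> [|N]; first by rewrite /avg mulr0 big1// => w _; rewrite big_ord0 mulr0.
apply: (@le_trans _ _ (avg (@ua_q R m N.+1)
   (fun w => C * \sum_x (1 + t) ^+ degree (@ua_inc m N.+1) w x))).
  apply: avg_le => [p x|w]; first exact: ua_q_ge0.
  rewrite natr_sum mulr_sumr; apply: ler_sum => x _.
  by rewrite natrX hC.
rewrite avgZ -mulrA ler_wpM2l ?(ltW C0)// avg_sum.
under eq_bigr do rewrite avg_exp_degree ?(ltW t0)//.
apply: (@sum_growth_prod _ N (fun x j => (if x == j.+1 then 1 + t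
     else if (x <= j)%N then 1 + t / j.+1%:R else 1) ^+ m)).
- move=> x j; rewrite exprn_ge0//; case: eqP => _; first by rewrite addr_ge0// ltW.
  by case: leqP => // _; rewrite addr_ge0// divr_ge0// ltW.
- move=> x j xj; rewrite xj; case: eqP => [xj'|_]; first by move: xj; rewrite xj' ltnn.
  have j0 : 0 < j.+1%:R :> R by rewrite ltr0n.
  have e : 2 * m%:R * (t / j.+1%:R) = 2^-1 / j.+1%:R.
    by rewrite mulrA e0.
  rewrite -e; apply: bernoulli_upper; first by rewrite divr_ge0// ltW.
  rewrite e ler_pdivrMr// mul1r; have : 1 <= j.+1%:R :> R by rewrite ler1n.
  lra.
- move=> j; rewrite eqxx.
  by have := @bernoulli_upper _ t m (ltW t0); rewrite e0; lra.
- move=> x j jx; rewrite gtn_eqF// leqNgt (ltn_trans _ jx)//= expr1n//.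
Qed.

(** * Lower bound on the variance *)

Section covariance.
Variables (R : realFieldType) (I : finType) (T : I -> finType).
Variable q : forall p, T p -> R.
Arguments q : clear implicits.
Hypothesis q_ge0 : forall p x, 0 <= q p x.
Hypothesis q_sum1 : forall p, \sum_x q p x = 1.
Notation Om := {dffun forall p : I, T p}.
Implicit Types (w v : Om) (f g : Om -> R).
Local Notation avg := (avg q).

Definition cov f g := avg (fun w => f w * g w) - avg f * avg g.

Lemma cov_sumr (J : finType) (A : pred J) f (g : J -> Om -> R) :
  cov f (fun w => \sum_(j | A j) g j w) = \sum_(j | A j) cov f (g j).
Proof.
rewrite /cov avg_sum mulr_sumr sumrB -avg_sum; congr (_ - _).
by apply: avg_ext => w; rewrite mulr_sumr.
Qed.

Lemma covDl f1 f2 g : cov (fun w => f1 w + f2 w) g = cov f1 g + cov f2 g.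
Proof.
rewrite /cov avgD (@avg_ext _ _ _ q _ (fun w => f1 w * g w + f2 w * g w)).
  by rewrite avgD; ring.
by move=> w; rewrite mulrDl.
Qed.

(** [f] ignores coordinate [p] and [g] depends on nothing else; exchanging this coordinate with an
    independent copy factorises the mean of the product. *)
Lemma cov_indep p f g :
  (forall w v, f (mix (pred1 p) w v) = f w) ->
  (forall w v, g (mix (pred1 p) w v) = g v) -> cov f g = 0.
Proof.
move=> hf hg; rewrite /cov; apply/eqP; rewrite subr_eq0; apply/eqP.
have -> : avg (fun w => f w * g w) = avg (fun w => avg (fun v => f w * g w)).
  by apply: avg_ext => w; rewrite (avg_cst q_sum1).
rewrite (avg2_swap _ (pred1 p)) -avgZr; apply: avg_ext => w; rewrite -avgZ.
by apply: avg_ext => v; rewrite hf hg.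
Qed.

(** The variance of [f - x * g] is nonnegative. With [x] left free, an upper bound on the variance
    of [g] is enough for a lower bound on that of [f]. *)
Lemma var_ge_cov f g (x : R) : 2 * x * cov f g - x ^+ 2 * var q g <= var q f.
Proof.
have h : 0 <= var q (fun w => f w - x * g w).
  by rewrite (varE q_sum1); apply: avg_ge0 => // w; exact: sqr_ge0.
have e : var q (fun w => f w - x * g w) =
    var q f - 2 * x * cov f g + x ^+ 2 * var q g.
  rewrite /var /cov avgB avgZ.
  rewrite (@avg_ext _ _ _ q _ 
    (fun w => f w ^+ 2 - (2 * x) * (f w * g w) + x ^+ 2 * g w ^+ 2)).
    by rewrite avgD avgB !avgZ; ring.
  by move=> w; ring.
by rewrite e in h; lra.
Qed.

End covariance.

(** A linear bound, by Pascal's rule, so that the mean number of stars can be bounded below through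
    mean degrees alone. *)
Lemma bin_ge_linear N r : (N <= 'C(N, r.+1) + r)%N.
Proof.
have [Nr|] := ltnP N r.+1; first by rewrite (leq_trans (_ : N <= r)%N)// leq_addl.
move=> /subnK <-; elim: (N - r.+1)%N => [|d IHd]; first by rewrite binn add1n.
by rewrite addSn binS addnAC (leq_trans _ (leq_add IHd (_ : 1 <= _)%N)) ?addn1// bin_gt0; lia.
Qed.

(** Each of the [Q] dyadic blocks, from [b] to [b + b], has [b] terms, all at least
    [(b + b)%:R^-1]. *)
Lemma harmonic_dyadic (R : realFieldType) k Q : (0 < k)%N ->
  Q%:R / 2 <= \sum_(k <= j < k * 2 ^ Q) (j.+1%:R)^-1 :> R.
Proof.
move=> k0; elim: Q => [|Q IHQ]; first by rewrite mul0r expn0 muln1 big_geq.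
have kQ : (k <= k * 2 ^ Q)%N by rewrite leq_pmulr ?expn_gt0.
rewrite (@big_cat_nat _ _ _ (k * 2 ^ Q)) //=; last by rewrite leq_mul2l leq_exp2l ?leqnSn ?orbT.
rewrite -natr1 mulrDl mul1r lerD//.
set b := (k * 2 ^ Q)%N.
have b0 : (0 < b)%N by rewrite muln_gt0 k0 expn_gt0.
have -> : (k * 2 ^ Q.+1 = b + b)%N by rewrite expnS /b; lia.
apply: (@le_trans _ _ (\sum_(b <= j < b + b) (b + b)%:R^-1)).
  have y0 : b%:R != 0 :> R by rewrite pnatr_eq0 -lt0n.
  rewrite sumr_const_nat addnK natrD -[X in _ <= X]mulr_natr.
  have -> : b%:R + b%:R = 2 * b%:R :> R by ring.
  by rewrite invfM -mulrA mulVf ?mulr1.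
rewrite !big_nat; apply: ler_sum => j /andP[_ jb].
by rewrite lef_pV2 ?posrE ?ltr0n ?addn_gt0 ?b0// ler_nat.
Qed.

Section lower.
Variables (R : realFieldType) (m l n : nat) (m_gt0 : (0 < m)%N).
Notation I := ('I_n.-1 * 'I_m)%type.
Notation Om := {dffun forall p : I, 'I_p.1.+1}.
Local Notation q := (@ua_q R m n).
Local Notation avg := (avg q).
Local Notation inc := (@ua_inc m n).
Implicit Types (w v : Om) (i j : 'I_n.-1).

(** Only edges labelled 0 are tested, one per vertex: [e i] is sent by vertex [i + 1], and [hit x i]
    says that it goes to [x]. *)
Let a0 : 'I_m := Ordinal m_gt0.
Let e i : I := (i, a0).
Let hit x i w := (w (e i) == x :> nat).

Lemma avg_hit x i : (x <= i)%N -> avg (fun w => (hit x i w)%:R) = i.+1%:R^-1.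
Proof.
move=> xi.
have eq w : (hit x i w)%:R =
    \prod_p (if p == e i then (w p == x :> nat)%:R else 1) :> R.
  by rewrite (bigD1 (e i)) //= eqxx big1 ?mulr1// => p /negbTE ->.
rewrite (@avg_ext _ _ _ q _ _ eq).
rewrite (avg_prod q (fun p z => if p == e i then (z == x :> nat)%:R else 1)).
rewrite (bigD1 (e i)) //= eqxx [X in _ * X]big1 ?mulr1; last first.
  move=> p /negbTE ->; under eq_bigr do rewrite mulr1; exact: ua_q_sum1.
have hx : (x < i.+1)%N by [].
rewrite (bigD1 (Ordinal hx)) //= eqxx mulr1 big1 ?addr0// => z.
by rewrite -val_eqE /= => /negbTE ->; rewrite mulr0.
Qed.

Lemma avg_hit2 x i j : i != j -> (x <= i)%N -> (x <= j)%N ->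
  avg (fun w => (hit x i w)%:R * (hit x j w)%:R) = i.+1%:R^-1 * j.+1%:R^-1.
Proof.
move=> ij xi xj.
have := @cov_indep _ _ _ q (@ua_q_sum1 R m n) (e j)
  (fun w => (hit x i w)%:R) (fun w => (hit x j w)%:R).
rewrite /cov !avg_hit// => h; apply/eqP; rewrite -subr_eq0; apply/eqP/h => w v.
  by rewrite /hit mixE /= xpair_eqE (negbTE ij).
by rewrite /hit mixE /= eqxx.
Qed.

(** The stars centred at [x] that consist of [e i] and [l.-1] of the edges [e j], [j] in [J], sent
    to [x]; these edges are not parallel, as distinct vertices send them. Their number
    ['C(#|A|, l.-1)] is at least [#|A|] minus [l.-2]. *)
Lemma stars_at_ge w (J : pred 'I_n.-1) x i : (1 < l)%N -> hit x i w ->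
  (forall j, J j -> (x <= j)%N) -> ~~ J i ->
  (\sum_(j | J j) (hit x j w)%:R) - (l.-2)%:R <= stars_at R l inc w (e i).
Proof.
move=> l1 hi Jx Ji.
pose A := [set p : I | [exists j, [&& p == e j, J j & hit x j w]]].
have inA p : p \in A -> [/\ p.2 = a0, J p.1, (x <= p.1)%N & w p = x :> nat].
  rewrite inE => /existsP[j /and3P[/eqP -> Jj /eqP hj]] /=.
  by split => //; exact: Jx.
have cA : \sum_(j | J j) (hit x j w)%:R = #|A|%:R :> R.
  have -> : A = [set e j | j in [set j | J j && hit x j w]].
    apply/setP => p; rewrite inE; apply/existsP/imsetP.
      by move=> [j /and3P[/eqP -> Jj hj]]; exists j; rewrite ?inE ?Jj.
    by move=> [j /[!inE] /andP[Jj hj] ->]; exists j; rewrite eqxx Jj.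
  rewrite card_imset; last by move=> j j' [].
  rewrite -sum1dep_card natr_sum big_mkcondr /=; apply: eq_bigr => j _.
  by case: (hit x j w).
pose D : {set {set I}} := [set B : {set I} | (B \subset A) && (#|B| == l.-1)].
have iA : e i \notin A by apply: contra Ji => /inA[].
have cD : 'C(#|A|, l.-1) = #|[set e i |: (B : {set I}) | B in D]|.
  rewrite -cards_draws card_in_imset// => B B' /[!inE] /andP[BA _] /andP[B'A _] BB'.
  have notin (C : {set I}) : C \subset A -> e i \notin C.
    by move=> CA; apply: contra iA; exact: (subsetP CA).
  by rewrite -(setU1K (notin _ BA)) BB' setU1K ?notin.
have sD : [set e i |: (B : {set I}) | B in D] \subset
    [set B : {set I} | (e i \in B) && star_set l (ends inc w) B].
  apply/subsetP => _ /imsetP[B /[!inE] /andP[BA /eqP Bl] ->].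
  rewrite setU11 /=; apply/star_setP.
  have iB : e i \notin B by apply: contra iA; exact: (subsetP BA).
  have hB p : p \in e i |: B -> w p = x :> nat /\ p.2 = a0.
    by move=> /setU1P[->|/(subsetP BA)/inA[]//]; split => //; apply/eqP.
  split.
  - by rewrite cardsU1 iB Bl add1n prednK// ltnW.
  - exists (old_vertex (w (e i))) => p pB; rewrite /ends /ua_inc !inE; apply/orP; right.
    by rewrite -val_eqE /= (hB _ pB).1 (hB _ (setU11 _ _)).1.
  (* Equal end sets force equal senders: the new vertex of [p] cannot be the common target [x],
     which is older. *)
  - move=> p r pB rB /setP/(_ (new_vertex p.1)).
    rewrite !inE eqxx /= => /esym/orP[].
      move: (hB p pB).2 (hB r rB).2; case: p r {pB rB} => [p1 p2] [r1 r2] /= -> ->.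
      by rewrite -val_eqE /= => /eqP[/val_inj ->].
    rewrite -val_eqE /= (hB r rB).1 -(hB p pB).1 => /eqP pw.
    by have := ltn_ord (w p); rewrite -pw ltnn.
have -> : stars_at R l inc w (e i) =
    #|[set B : {set I} | (e i \in B) && star_set l (ends inc w) B]|%:R.
  rewrite /stars_at -sum1dep_card natr_sum big_mkcondr /=; apply: eq_bigr => B _.
  by case: (star_set _ _ _).
rewrite cA lerBlDr -natrD ler_nat.
have := subset_leq_card sD; rewrite -cD => h.
have := bin_ge_linear #|A| l.-2; case: l l1 h => [|[|l']]//= _ h h'.
by rewrite (leq_trans h')// leq_add2r.
Qed.

Let psi k i w : R := (w (e i) < k)%:R.

Lemma psiE k i w : psi k i w = \sum_(x < k) (hit x i w)%:R.
Proof.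
rewrite /psi; case: ltnP => wk.
  rewrite (bigD1 (Ordinal wk)) //= /hit eqxx big1 ?addr0// => x.
  by rewrite -val_eqE /= eq_sym => /negbTE ->.
by rewrite big1// => x _; rewrite /hit gtn_eqF// (leq_trans _ wk).
Qed.

Lemma avg_psi k i : (k <= i.+1)%N -> avg (psi k i) = k%:R / i.+1%:R.
Proof.
move=> ki; rewrite (@avg_ext _ _ _ q _ _ (psiE k i)) avg_sum.
rewrite (eq_bigr (fun=> i.+1%:R^-1)) => [|x _].
  by rewrite sumr_const card_ord mulr_natl.
by rewrite avg_hit// -ltnS (leq_trans (ltn_ord x)).
Qed.

(** Stars avoiding [e i] are independent of the choice made by [e i], so only the stars through
    [e i] contribute. *)
Lemma cov_stars_psi k i : cov q (stars R l inc) (psi k i) =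
  avg (fun w => stars_at R l inc w (e i) * psi k i w) -
  avg (fun w => stars_at R l inc w (e i)) * avg (psi k i).
Proof.
have eW w : stars R l inc w =
    \sum_(B : {set I} | e i \notin B) (star_set l (ends inc w) B)%:R + stars_at R l inc w (e i).
  by rewrite /stars star_countE (bigID (fun B : {set I} => e i \in B)) addrC.
have -> : cov q (stars R l inc) (psi k i) = cov q (fun w =>
    \sum_(B : {set I} | e i \notin B) (star_set l (ends inc w) B)%:R +
    stars_at R l inc w (e i)) (psi k i).
  by rewrite /cov; congr (_ - _ * _); apply: avg_ext => w; rewrite eW.
rewrite covDl (@cov_indep _ _ _ q (@ua_q_sum1 R m n) (e i)) ?add0r//.
- move=> w v; apply: eq_bigr => B iB; congr (_%:R); congr (nat_of_bool _).
  apply: star_set_eq => p pB; rewrite /ends mixE /=; case: eqP => // pe.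
  by move: iB; rewrite -pe pB.
- by move=> w v; rewrite /psi mixE /= eqxx.
Qed.

(** Given that [e i] goes to some [x < k], each [e j] with [k <= j < b] goes to [x] with probability
    [j.+1%:R^-1], which bounds the mean number of stars at [e i] from below. The condition [b <= i]
    keeps [e i] out of these edges. *)
Lemma cov_stars_psi_ge k b i : (1 < l)%N -> (k <= b)%N -> (b <= i)%N ->
  k%:R / i.+1%:R * (\sum_(k <= j < b) j.+1%:R^-1 - l.-2%:R -
    avg (fun w => stars_at R l inc w (e i))) <= cov q (stars R l inc) (psi k i).
Proof.
move=> l1 kb bi; rewrite cov_stars_psi avg_psi ?(leq_trans kb) ?(leq_trans bi)//.
rewrite mulrBr [_ * avg _]mulrC lerD2r.
pose J := [pred j : 'I_n.-1 | (k <= j < b)%N].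
have eJ : \sum_(k <= j < b) j.+1%:R^-1 = \sum_(j | J j) j.+1%:R^-1 :> R.
  rewrite big_geq_mkord (big_ord_widen_cond n.-1
    (fun u : nat => (k <= u)%N) (fun u : nat => u.+1%:R^-1)).
    by apply: eq_bigl.
  by rewrite (leq_trans bi)// ltnW.
apply: (@le_trans _ _ (avg (fun w => \sum_(x < k)
    (\sum_(j | J j) (hit x i w)%:R * (hit x j w)%:R - l.-2%:R * (hit x i w)%:R)))).
  rewrite avg_sum [X in _ <= X](eq_bigr
    (fun=> i.+1%:R^-1 * (\sum_(j | J j) j.+1%:R^-1 - l.-2%:R))).
    by rewrite sumr_const card_ord -[X in _ <= X]mulr_natl eJ mulrA.
  move=> x _; have xi : (x <= i)%N by rewrite (leq_trans (ltnW (ltn_ord x)))// (leq_trans kb).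
  rewrite avgB avg_sum avgZ avg_hit// mulrBr [_ * _%:R]mulrC mulr_sumr; congr (_ - _).
  apply: eq_bigr => j /andP[kj jb]; rewrite avg_hit2//.
    by rewrite -val_eqE /= gtn_eqF// (leq_trans jb).
  by rewrite (leq_trans (ltnW (ltn_ord x))).
apply: avg_le => [p x|w]; first exact: ua_q_ge0.
rewrite psiE mulr_sumr; apply: ler_sum => x _.
case: (boolP (hit x i w)) => hx; last by rewrite !mulr0 subr0 big1// => j _; rewrite mul0r.
rewrite !mulr1; under eq_bigr do rewrite mul1r.
apply: stars_at_ge => //.
  by move=> j /andP[kj _]; rewrite (leq_trans (ltnW (ltn_ord x))).
by rewrite /= ltnNge bi andbF.
Qed.

(** Efron-Stein: resampling one edge changes the sum by at most one. *)
Lemma var_sum_psi_le k b :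
  var q (fun w => \sum_(i : 'I_n.-1 | (b <= i)%N) psi k i w) <= (m * n)%:R.
Proof.
apply: le_trans (efron_stein (@ua_q_ge0 R m n) (@ua_q_sum1 R m n) _) _.
apply: (@le_trans _ _ (2^-1 * \sum_(p : I) 1)).
  apply: ler_wpM2l; first by rewrite invr_ge0.
  apply: ler_sum => p _; rewrite -[leRHS](avg_cst (@ua_q_sum1 R m n)).
  apply: avg_le => [? ?|w]; first exact: ua_q_ge0.
  rewrite -[leRHS](avg_cst (@ua_q_sum1 R m n)).
  apply: avg_le => [? ?|v]; first exact: ua_q_ge0.
  rewrite -real_normK ?num_real// expr_le1//.
  rewrite /incr -sumrB (le_trans (ler_norm_sum _ _ _))//.
  apply: (@le_trans _ _ (\sum_(i : 'I_n.-1) (i == p.1)%:R)).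
    rewrite big_mkcond; apply: ler_sum => i _; case: ifP => // _.
    rewrite /psi mixE /=; case: eqP => [<-|_] /=; last by rewrite subrr normr0.
    rewrite eqxx; do 2 case: (_ < _)%N;
      by rewrite ?subrr ?subr0 ?sub0r ?normrN ?normr0 ?normr1.
  by rewrite (bigD1 p.1) //= eqxx big1 ?addr0// => i /negbTE ->.
rewrite sumr_const card_prod !card_ord -[leRHS]mul1r.
apply: ler_pM => //; first by rewrite invr_ge0.
  by lra.
by rewrite ler_nat mulnC leq_mul2l leq_pred orbT.
Qed.

End lower.

Lemma var_stars_lower (R : archiRealFieldType) (m l : nat) (K : R) :
  (0 < m)%N -> (1 < l)%N -> 0 <= K ->
  (forall n, \sum_p avg (@ua_q R m n) (fun w => stars_at R l (@ua_inc m n) w p) <= K * n%:R) ->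
  exists c : R, 0 < c /\ exists N, forall n, (N <= n)%N ->
    c * n%:R <= var (@ua_q R m n) (stars R l (@ua_inc m n)).
Proof.
move=> m0 l1 K0 hK.
have card_aux x y : (y * 2 <= x -> 4 <= x -> x <= 4 * (x.-1 - y))%N by lia.
have exp_aux u v : (2 ^ u.+2 * v = 4 * (v * 2 ^ u))%N by rewrite !expnS; lia.
(* [Q] is even, so that [Q%:R / 2] is a natural number, and so large that the harmonic sum over [Q]
   dyadic blocks exceeds [l.-2%:R] by at least [16 * K + 4]. *)
pose Q := ((Num.truncn (16 * K + 4)).+1 + l.-2).*2.
have hQ : 16 * K + 4 <= Q%:R / 2 - l.-2%:R.
  have -> : Q%:R / 2 = ((Num.truncn (16 * K + 4)).+1 + l.-2)%:R :> R.
    by rewrite /Q -muln2 natrM mulfK ?pnatr_eq0.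
  by rewrite natrD addrK ltW// truncnS_gt.
have m0R : 0 < m%:R :> R by rewrite ltr0n.
pose d : R := (2 ^ Q.+2)%:R^-1.
have d0 : 0 < d by rewrite invr_gt0 ltr0n expn_gt0.
exists (d ^+ 2 / m%:R); split; first by rewrite divr_gt0// exprn_gt0.
exists (2 ^ Q.+2)%N => n nN.
(* The range from [k] to [b] consists of [Q] dyadic blocks, and [b] lies between [n / 4] and
   [n / 2], which leaves at least [n / 4] late edges. *)
pose k := (n %/ 2 ^ Q.+1)%N; pose b := (k * 2 ^ Q)%N.
have P0 : (0 < 2 ^ Q.+1)%N by rewrite expn_gt0.
have k0 : (0 < k)%N by rewrite divn_gt0// (leq_trans _ nN)// leq_exp2l.
have kb : (k <= b)%N by rewrite leq_pmulr ?expn_gt0.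
have bn : (b * 2 <= n)%N by rewrite /b -mulnA -expnSr leq_trunc_div.
have nk : (n <= 4 * b)%N.
  have : (n < k.+1 * 2 ^ Q.+1)%N by rewrite ltn_ceil.
  have : (k.+1 * 2 ^ Q.+1 <= 2 * k * 2 ^ Q.+1)%N by rewrite leq_mul2r; lia.
  by rewrite expnS /b; lia.
have n0 : 0 < n%:R :> R by rewrite ltr0n; lia.
pose W := stars R l (@ua_inc m n).
pose S (w : {dffun forall p : 'I_n.-1 * 'I_m, 'I_p.1.+1}) :=
  \sum_(i : 'I_n.-1 | (b <= i)%N) (w (i, Ordinal m0) < k)%:R : R.
pose EW (i : 'I_n.-1) := avg (@ua_q R m n)
  (fun w => stars_at R l (@ua_inc m n) w (i, Ordinal m0)).
have EW0 i : 0 <= EW i.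
  by apply: (avg_ge0 (@ua_q_ge0 R m n) (@ua_q_sum1 R m n)) => w; exact: sumr_ge0.
have sEW : \sum_(i : 'I_n.-1 | (b <= i)%N) EW i <= K * n%:R.
  apply: le_trans (hK n).
  have -> : \sum_p avg (@ua_q R m n) (fun w => stars_at R l (@ua_inc m n) w p) =
      \sum_(i < n.-1) \sum_(a < m) avg (@ua_q R m n)
        (fun w => stars_at R l (@ua_inc m n) w (i, a)).
    by rewrite [RHS]pair_bigA; apply: eq_bigr => -[i a] _.
  rewrite big_mkcond.
  apply: ler_sum => i _; have E0 a : 0 <= avg (@ua_q R m n)
     (fun w => stars_at R l (@ua_inc m n) w (i, a)).
    by apply: (avg_ge0 (@ua_q_ge0 R m n) (@ua_q_sum1 R m n)) => w; exact: sumr_ge0.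
  case: ifP => _; last exact: sumr_ge0.
  by rewrite (bigD1 (Ordinal m0)) //= lerDl sumr_ge0.
have kR : 0 < k%:R :> R by rewrite ltr0n.
set X := Q%:R / 2 - l.-2%:R in hQ.
have X0 : 0 <= X by apply: le_trans hQ; rewrite addr_ge0 ?mulr_ge0.
pose r : R := k%:R / n%:R.
have r0 : 0 <= r by rewrite divr_ge0.
(* As [X >= 16 * K + 4], the main term, at least [r * X * n / 4], exceeds the loss, at most
   [4 * r * K * n], by at least [r * n = k]. *)
have hcov : k%:R <= cov (@ua_q R m n) W S.
  rewrite cov_sumr.
  apply: (@le_trans _ _ (\sum_(i : 'I_n.-1 | (b <= i)%N) (r * X - 4 * r * EW i))).
    rewrite sumrB.
    have cH : (n <= 4 * \sum_(i : 'I_n.-1 | (b <= i)%N) 1)%N.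
      rewrite -(big_geq_mkord _ _ xpredT (fun=> 1%N)) sum_nat_const_nat muln1.
      by apply: card_aux bn _; rewrite (leq_trans _ nN)// (@leq_exp2l 2 2).
    pose c := (\sum_(i : 'I_n.-1 | (b <= i)%N) 1)%N; rewrite -/c in cH.
    have -> : \sum_(i : 'I_n.-1 | (b <= i)%N) r * X = r * X * c%:R.
      by rewrite natr_sum mulr_sumr; apply: eq_bigr => i _; rewrite mulr1.
    rewrite -mulr_sumr.
    have cR : n%:R / 4 <= c%:R :> R by rewrite ler_pdivrMr// mulrC -natrM ler_nat.
    have e1 : k%:R = r * n%:R by rewrite /r mulfVK// gt_eqF.
    have h1 : r * X * (n%:R / 4) <= r * X * c%:R by rewrite ler_wpM2l// mulr_ge0.
    have h2 : 4 * r * \sum_(i : 'I_n.-1 | (b <= i)%N) EW i <= 4 * r * (K * n%:R).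
      by rewrite ler_wpM2l// mulr_ge0.
    have h3 : k%:R * (16 * K + 4) <= k%:R * X by rewrite ler_wpM2l// ltW.
    rewrite e1 in h3 *; lra.
  apply: ler_sum => i bi.
  apply: le_trans (cov_stars_psi_ge R m0 l1 kb bi).
  have iR : 0 < i.+1%:R :> R by rewrite ltr0n.
  have r1 : r <= k%:R / i.+1%:R.
    rewrite ler_pM2l// lef_pV2 ?posrE// ler_nat.
    by rewrite (leq_trans (ltn_ord i))// leq_pred.
  have r4 : k%:R / i.+1%:R <= 4 * r.
    rewrite /r mulrCA ler_pM2l// -[leLHS]mul1r ler_pdivrMr// mulrAC ler_pdivlMr// mul1r.
    by rewrite -natrM ler_nat (leq_trans nk)// leq_mul2l leqW.
  have hh := harmonic_dyadic R Q k0; rewrite -/b in hh.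
  have a1 : r * X <= k%:R / i.+1%:R * X by rewrite ler_wpM2r.
  have a2 : k%:R / i.+1%:R * EW i <= 4 * r * EW i by rewrite ler_wpM2r.
  rewrite -/(EW i); set h := \sum_(k <= j < b) _ in hh *.
  have a3 : k%:R / i.+1%:R * X <= k%:R / i.+1%:R * (h - l.-2%:R).
    by rewrite ler_wpM2l ?divr_ge0// /X lerD2r.
  by rewrite [leRHS]mulrBr; exact: lerB (le_trans a1 a3) a2.
have hS : var (@ua_q R m n) S <= _ := @var_sum_psi_le R m n m0 k b.
(* The value [x = d / m] maximises [2 * x * (d * n) - x ^ 2 * (m * n)]; the maximum is
   [d ^ 2 * n / m]. *)
have := var_ge_cov (@ua_q_ge0 R m n) (@ua_q_sum1 R m n) W S (d / m%:R).
apply: le_trans.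
have dk : d * n%:R <= k%:R.
  rewrite /d ler_pdivrMl ?ltr0n ?expn_gt0// -natrM ler_nat.
  by rewrite exp_aux.
have x0 : 0 <= d / m%:R by rewrite divr_ge0// ltW.
have h1 : 2 * (d / m%:R) * (d * n%:R) <= 2 * (d / m%:R) * cov (@ua_q R m n) W S.
  by apply: ler_wpM2l; [rewrite mulr_ge0|exact: le_trans dk hcov].
have h2 : (d / m%:R) ^+ 2 * var (@ua_q R m n) S <= (d / m%:R) ^+ 2 * (m * n)%:R.
  by apply: ler_wpM2l; [exact: sqr_ge0|exact: hS].
have e3 : d ^+ 2 / m%:R * n%:R = 2 * (d / m%:R) * (d * n%:R) - (d / m%:R) ^+ 2 * (m * n)%:R.
  by rewrite natrM; field; rewrite gt_eqF.
by rewrite e3 lerB.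
Qed.

(** * Stein's equation *)

From mathcomp Require Import all_classical all_reals all_analysis.
From mathcomp Require Import measurable_realfun.
Import numFieldNormedType.Exports.
Local Open Scope classical_set_scope.
Local Open Scope ring_scope.

Section stein.
Variable R : realType.
Implicit Types (u du h : R -> R) (x y z w M A e : R).

Lemma is_derive_cont u a w : is_derive w 1 u a -> {for w, continuous u}.
Proof.
by move=> h; apply: differentiable_continuous; apply/derivable1_diffP; case: h.
Qed.

Lemma derive_ge0_homo u du a :
  (forall x, a <= x -> is_derive x 1 u (du x)) ->
  (forall x, a <= x -> 0 <= du x) ->
  forall x y, a <= x -> x <= y -> u x <= u y.
Proof.
move=> hu du0 x y ax xy.
have ge_a z : z \in `[x, y] -> a <= z by move=> zxy; rewrite (le_trans ax) ?(itvP zxy).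
have [z zxy||c cxy e] := @MVT_segment _ u du x y xy.
- by apply: hu; apply: le_trans ax _; rewrite (itvP zxy).
- apply: continuous_in_subspaceT => z /set_mem zxy.
  by apply: is_derive_cont (hu z _); exact: ge_a.
by rewrite -subr_ge0 e mulr_ge0 ?subr_ge0// du0// ge_a.
Qed.

Lemma mean_value_eq u du x y : (forall x, is_derive x 1 u (du x)) ->
  exists c, `|c - x| <= `|y - x| /\ u y - u x = du c * (y - x).
Proof.
move=> hu; have cu : continuous u by move=> z; exact: is_derive_cont (hu z).
have [xy|yx] := leP x y.
  have [|c cxy e] := MVT_segment xy (fun z _ => hu z).
    exact: continuous_subspaceT.
  exists c; split => //; rewrite !ger0_norm ?subr_ge0 ?lerB ?(itvP cxy)//.
have [|c cxy e] := MVT_segment (ltW yx) (fun z _ => hu z).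
  exact: continuous_subspaceT.
exists c; split; last by rewrite -opprB e; ring.
by rewrite !ler0_norm ?subr_le0 ?lerN2 ?lerB ?(itvP cxy)// ltW.
Qed.

Lemma is_derive_gauss x :
  is_derive x 1 (fun t : R => expR (- (t ^+ 2 / 2))) (- x * expR (- (x ^+ 2 / 2))).
Proof.
by apply: is_derive_eq; rewrite /GRing.scale /=; field.
Qed.

(* The barrier [B w = A + 2 M / (1 + w)] satisfies [B' - w B <= - (A w + M)]. *)
Lemma barrier_upper u du A M : 0 <= A -> 0 <= M ->
  (forall w, is_derive w 1 u (du w)) ->
  (forall w, 0 <= w -> `|du w - w * u w| <= A * w + M) ->
  (forall e b, 0 < e -> exists2 w, b <= w & u w * expR (- (w ^+ 2 / 2)) <= e) ->
  forall w, 0 <= w -> u w <= A + 2 * M / (1 + w).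
Proof.
move=> A0 M0 hu hL hlim w w0.
pose B (t : R) := A + 2 * M * (1 + t)^-1.
(* [u - B] times the integrating factor of [u' - t * u]. It is nondecreasing on the positive
   half-line, so a positive value would persist and contradict [hlim]. *)
pose q (t : R) := (u t - B t) * expR (- (t ^+ 2 / 2)).
pose dq (t : R) := (du t + 2 * M / (1 + t) ^+ 2 - t * (u t - B t)) *
  expR (- (t ^+ 2 / 2)).
have hdq (t : R) : 0 <= t -> is_derive t 1 q (dq t).
  move=> t0; have t1 : 1 + t != 0 by rewrite gt_eqF// ltr_pwDl.
  have h1 : is_derive t 1 (fun t : R => (1 + t)^-1) (- (1 + t) ^- 2).
    by apply: is_derive_eq; rewrite add0r [_ *: _]mulr1.
  have h2 := is_derive_gauss t.
  have h3 := hu t.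
  rewrite /q /B; apply: is_derive_eq.
  rewrite /dq /B /GRing.scale /=.
  by field.
have dq0 (t : R) : 0 <= t -> 0 <= dq t.
  move=> t0; rewrite mulr_ge0 ?expR_ge0//.
  have := hL t t0; rewrite ler_norml => /andP[h _].
  suff : A * t + M <= 2 * M / (1 + t) ^+ 2 + t * B t by lra.
  have -> : 2 * M / (1 + t) ^+ 2 + t * B t =
     A * t + M + M * (1 + t ^+ 2) / (1 + t) ^+ 2.
    by rewrite /B; field; rewrite gt_eqF// ltr_pwDl.
  by rewrite lerDl !mulr_ge0// ?invr_ge0 ?exprn_ge0 ?addr_ge0 ?sqr_ge0.
have hq := derive_ge0_homo hdq dq0.
rewrite leNgt; apply/negP => wB.
have qw : 0 < q w by rewrite mulr_gt0 ?expR_gt0// subr_gt0.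
have [z wz zq] := hlim (q w / 2) w ltac:(lra).
have := hq _ _ w0 wz; apply/negP; rewrite -ltNge.
apply: (@le_lt_trans _ _ (q w / 2)); last by lra.
apply: le_trans zq; rewrite ler_wpM2r ?expR_ge0// gerBl /B.
by rewrite addr_ge0// !mulr_ge0// invr_ge0 addr_ge0// (le_trans w0).
Qed.

Lemma barrier u du A M : 0 <= A -> 0 <= M ->
  (forall w, is_derive w 1 u (du w)) ->
  (forall w, 0 <= w -> `|du w - w * u w| <= A * w + M) ->
  (forall e b, 0 < e -> exists2 w, b <= w & `|u w| * expR (- (w ^+ 2 / 2)) <= e) ->
  forall w, 0 <= w -> `|u w| <= A + 2 * M / (1 + w).
Proof.
move=> A0 M0 hu hL hlim w w0.
rewrite ler_norml lerNl; apply/andP; split.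
  apply: (@barrier_upper (fun t => - u t) (fun t => - du t)) => //.
    by move=> t t0; rewrite mulrN opprK -normrN opprD opprK hL.
  move=> e b e0; have [t bt ht] := hlim e b e0; exists t => //.
  by apply: le_trans ht; rewrite ler_wpM2r ?expR_ge0// -normrN ler_norm.
apply: (@barrier_upper u du) => //.
move=> e b e0; have [t bt ht] := hlim e b e0; exists t => //.
by apply: le_trans ht; rewrite ler_wpM2r ?expR_ge0// ler_norm.
Qed.

Lemma barrier_both u du A M : 0 <= A -> 0 <= M ->
  (forall w, is_derive w 1 u (du w)) ->
  (forall w, `|du w - w * u w| <= A * `|w| + M) ->
  (forall e b, 0 < e -> exists2 w, b <= w &
     `|u w| * expR (- (w ^+ 2 / 2)) <= e /\
     `|u (- w)| * expR (- (w ^+ 2 / 2)) <= e) ->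
  forall w, `|u w| <= A + 2 * M / (1 + `|w|).
Proof.
move=> A0 M0 hu hL hlim w.
have [w0|w0] := leP 0 w.
  rewrite (ger0_norm w0); apply: (@barrier u du) => //.
    by move=> t t0; have := hL t; rewrite (ger0_norm t0).
  by move=> e b e0; have [t bt [ht _]] := hlim e b e0; exists t.
rewrite (ltr0_norm w0).
have -> : u w = u (- (- w)) by rewrite opprK.
apply: (@barrier (fun t => u (- t)) (fun t => - du (- t))) => //.
- move=> t; have := hu (- t) => h.
  have h2 : is_derive t 1 (fun t : R => - t) (-1) by apply: is_derive_eq.
  have -> : - du (- t) = du (- t) * - 1 by rewrite mulrN1.
  exact: (is_derive1_comp h h2).
- move=> t t0; have := hL (- t); rewrite normrN (ger0_norm t0).
  by rewrite mulNr opprK -[in X in X -> _]normrN opprD.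
- by move=> e b e0; have [t bt [_ ht]] := hlim e b e0; exists t.
- by rewrite oppr_ge0 ltW.
Qed.

Lemma bounded_decay u K : (forall w, `|u w| <= K) ->
  forall e b, 0 < e -> exists2 w, b <= w &
     `|u w| * expR (- (w ^+ 2 / 2)) <= e /\
     `|u (- w)| * expR (- (w ^+ 2 / 2)) <= e.
Proof.
move=> uK e b e0.
have K0 : 0 <= K := le_trans (normr_ge0 _) (uK 0).
pose w := Num.max b (1 + 2 * K / e).
have w1 : 1 + 2 * K / e <= w by rewrite le_max lexx orbT.
have Ke : 0 <= 2 * K / e by rewrite !mulr_ge0// invr_ge0 ltW.
exists w; first by rewrite le_max lexx.
suff h x : `|u x| * expR (- (w ^+ 2 / 2)) <= e by split.
apply: (@le_trans _ _ (K * (1 + w ^+ 2 / 2)^-1)).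
  apply: ler_pM; rewrite ?expR_ge0// expRN lef_pV2 ?posrE ?expR_gt0 ?expR_ge1Dx//.
  by rewrite ltr_pwDl// divr_ge0 ?sqr_ge0.
have w2 : 0 < 1 + w ^+ 2 / 2 by rewrite ltr_pwDl// divr_ge0 ?sqr_ge0.
rewrite ler_pdivrMr// -ler_pdivrMl// mulrC.
have : 2 * K / e <= w ^+ 2 by apply: le_trans (_ : w <= _); [lra|rewrite expr2 ler_peMr//; lra].
have -> : K / e = 2 * K / e / 2 by field; rewrite gt_eqF.
lra.
Qed.

(* Apply the barrier to [F], then to its difference quotients. *)
Lemma stein_solution_bounds (F h : R -> R) (c : R) : 0 <= c ->
  (forall x y, `|h x - h y| <= `|x - y|) ->
  `|h 0| <= c ->
  (forall w, is_derive w 1 F (w * F w + h w)) ->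
  (forall e b, 0 < e -> exists2 w, b <= w &
     `|F w| * expR (- (w ^+ 2 / 2)) <= e /\
     `|F (- w)| * expR (- (w ^+ 2 / 2)) <= e) ->
  let K := 10 * (c + 1) in
  (forall w, `|w * F w + h w| <= K) /\
  (forall x y, `|F y - F x - (x * F x + h x) * (y - x)| <= K * (y - x) ^+ 2).
Proof.
move=> c0 hh h0 hF dF K.
have hgr w : `|h w| <= 1 * `|w| + c.
  have := hh w 0; rewrite subr0 mul1r => hw.
  have -> : h w = (h w - h 0) + h 0 by ring.
  by rewrite (le_trans (ler_normD _ _))// lerD.
(* The barrier with [A = 1] and [M = c], as [h] grows at most like [|w| + c]. *)
have Fb w : `|F w| <= 1 + 2 * c.
  have := @barrier_both F (fun w => w * F w + h w) 1 c ler01 c0 hF _ dF w.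
  move=> /(_ (fun t => ltac:(by rewrite addrAC subrr add0r))) /le_trans; apply.
  by rewrite lerD2l ler_piMr ?mulr_ge0// invf_le1 ?ltr_pwDl// lerDl.
pose M := 2 + 2 * c.
have M0 : 0 <= M by rewrite /M; lra.
(* A difference quotient [D] satisfies [D' - t * D = F (t + d) + (h (t + d) - h t) / d], which is
   bounded by [M]; so the barrier applies with [A = 0]. *)
have dq d w : d != 0 -> `|(F (w + d) - F w) / d| <= 2 * M / (1 + `|w|).
  move=> d0.
  rewrite -[leRHS]add0r.
  apply: (@barrier_both (fun w => (F (w + d) - F w) / d)
    (fun w => ((w + d) * F (w + d) + h (w + d) - (w * F w + h w)) / d)) => //.
  - move=> t; have h1 := hF t; have h2 := hF (t + d).
    have h3 : is_derive t 1 (fun t : R => t + d) 1 by apply: is_derive_eq; rewrite addr0.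
    have h4 := @is_derive1_comp _ F (fun t : R => t + d) t _ _ h2 h3; rewrite mulr1 in h4.
    have h5 : is_derive t 1 (fun w => F (w + d)) ((t + d) * F (t + d) + h (t + d)) := h4.
    apply: is_derive_eq.
    rewrite /GRing.scale /= mulrC; field.
    by rewrite d0.
  - move=> t; rewrite mul0r add0r.
    have -> : ((t + d) * F (t + d) + h (t + d) - (t * F t + h t)) / d -
       t * ((F (t + d) - F t) / d) = F (t + d) + (h (t + d) - h t) / d.
      by field.
    rewrite (le_trans (ler_normD _ _))// /M.
    have := Fb (t + d); have : `|(h (t + d) - h t) / d| <= 1; last by lra.
    rewrite normrM normfV ler_pdivrMr ?normr_gt0// mul1r.
    by have := hh (t + d) t; rewrite addrAC subrr add0r.
  - apply: (@bounded_decay _ (2 * (1 + 2 * c) / `|d|)) => t.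
    rewrite normrM normfV ler_wpM2r ?invr_ge0// (le_trans (ler_normB _ _))//.
    by have := Fb (t + d); have := Fb t; lra.
have M2 w : 2 * M / (1 + `|w|) <= 2 * M.
  by rewrite ler_piMr ?mulr_ge0// invf_le1 ?ltr_pwDl// lerDl.
(* The decay of the barrier compensates the factor [w] in [w * F w + h w], which makes this
   derivative of [F] Lipschitz. *)
have wM2 w : `|w| * (2 * M / (1 + `|w|)) <= 2 * M.
  rewrite mulrCA mulrC ler_piMl ?mulr_ge0//.
  by rewrite ler_pdivrMr ?ltr_pwDl// mul1r lerDr.
have lipF x y : `|F y - F x| <= 2 * M * `|y - x|.
  have [->|xy] := eqVneq y x; first by rewrite !subrr normr0 mulr0.
  have d0 : y - x != 0 by rewrite subr_eq0.
  have := le_trans (dq (y - x) x d0) (M2 x).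
  rewrite subrKC normrM normfV ler_pdivrMr ?normr_gt0//.
have lipG x y : `|(y * F y + h y) - (x * F x + h x)| <= 6 * (c + 1) * `|y - x|.
  have [->|xy] := eqVneq y x; first by rewrite !subrr normr0 mulr0.
  have d0 : y - x != 0 by rewrite subr_eq0.
  have -> : (y * F y + h y) - (x * F x + h x) =
     (y - x) * (x * ((F y - F x) / (y - x)) + F y) + (h y - h x).
    by field.
  rewrite (le_trans (ler_normD _ _))//.
  have : `|(y - x) * (x * ((F y - F x) / (y - x)) + F y)| <=
     (2 * M + (1 + 2 * c)) * `|y - x|.
    rewrite normrM mulrC ler_wpM2r// (le_trans (ler_normD _ _))// lerD//.
    rewrite normrM; apply: le_trans (wM2 x); rewrite ler_wpM2l//.
    by have := dq (y - x) x d0; rewrite subrKC.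
  have := hh y x; rewrite /K /M; have := normr_ge0 (y - x); nra.
split=> [w|x y].
  (* Within distance one of [w] the derivative equals a difference quotient, which is at most
     [2 * M]; the Lipschitz bound carries this over to [w]. *)
  have [c' [cw e]] := mean_value_eq w (w + 1) hF.
  have := lipG c' w; have := dq 1 w (oner_neq0 _); have := M2 w.
  move: cw; rewrite e addrAC subrr add0r mulr1 divr1 normr1 distrC => cw h1 h2 h3.
  have {}cw : 6 * (c + 1) * `|w - c'| <= 6 * (c + 1).
    by rewrite ler_piMr ?mulr_ge0 ?addr_ge0// distrC.
  have -> : w * F w + h w = (w * F w + h w - (c' * F c' + h c')) +
    (c' * F c' + h c') by ring.
  rewrite (le_trans (ler_normD _ _))//.
  have : `|c' * F c' + h c'| <= 2 * M by apply: le_trans h1.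
  rewrite /K /M; lra.
have [c' [cx e]] := mean_value_eq x y hF.
rewrite e -mulrBl normrM.
have := lipG x c' => hl.
have K0 : 0 <= K by rewrite /K mulr_ge0 ?addr_ge0.
have {}hl : `|c' * F c' + h c' - (x * F x + h x)| <= K * `|c' - x|.
  by apply: le_trans hl _; rewrite ler_wpM2r// ler_wpM2r ?addr_ge0// ler_nat.
apply: (@le_trans _ _ (K * `|c' - x| * `|y - x|)); first by rewrite ler_wpM2r.
by rewrite -mulrA ler_wpM2l// -real_normK ?num_real// expr2 ler_wpM2r.
Qed.
End stein.

(** * The standard normal law and the solution of Stein's equation *)

Section normal.
Variable R : realType.
Implicit Types (u du h : R -> R) (x y z w M A e : R).
Local Notation mu := (@lebesgue_measure R).
Local Notation phi := (normal_pdf (0:R) 1).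

Lemma normal_pdf01E x : phi x = normal_peak 1 * expR (- (x ^+ 2 / 2)).
Proof.
rewrite normal_pdfE ?oner_eq0// /normal_fun subr0 expr1n.
by congr (_ * expR _); rewrite mulNr.
Qed.

Lemma measurable_lipschitz h : (forall x y, `|h x - h y| <= `|x - y|) ->
  measurable_fun [set: measurableTypeR R] h.
Proof.
move=> hh; apply: continuous_measurable_fun => x.
apply/cvgrPdist_le => e e0; near=> t.
apply: le_trans (hh _ _) _; near: t.
by apply: cvgr_dist_le.
Unshelve. all: by end_near. Qed.

(** Both densities integrate over every measurable set to its normal probability. *)
Lemma ae_eq_normal_density :
  ae_eq mu setT (Radon_Nikodym_SigmaFinite.f (normal_prob (0:R) 1) mu)
    (EFin \o phi).
Proof.
have dom := @normal_prob_dominates R 0 1.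
apply: integral_ae_eq => //.
- exact: Radon_Nikodym_SigmaFinite.f_integrable.
- by apply/measurable_EFinP; exact: measurable_normal_pdf.
- by move=> E _ mE; rewrite -Radon_Nikodym_SigmaFinite.f_integral.
Qed.

Lemma ge0_integral_normal (f : R -> \bar R) : measurable_fun setT f ->
  (forall x, 0 <= f x)%E ->
  (\int[normal_prob 0 1]_x f x = \int[mu]_x (f x * (phi x)%:E))%E.
Proof.
move=> mf f0.
have dom := @normal_prob_dominates R 0 1.
rewrite -(@Radon_Nikodym_SigmaFinite.change_of_variables _ _ _ _ mu dom)//.
apply: ae_eq_integral => //.
- apply: emeasurable_funM => //.
  exact: measurable_int (Radon_Nikodym_SigmaFinite.f_integrable dom).
- apply: emeasurable_funM => //.
  by apply/measurable_EFinP; exact: measurable_normal_pdf.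
- exact: ae_eqe_mul2l ae_eq_normal_density.
Qed.

Lemma integrable_normal (f : R -> R) : measurable_fun setT f ->
  mu.-integrable setT (fun x => (f x * phi x)%:E) ->
  (normal_prob 0 1).-integrable setT (EFin \o f) /\
  (\int[normal_prob 0 1]_x (f x)%:E = \int[mu]_x (f x * phi x)%:E)%E.
Proof.
move=> mf fi.
have phi0 x : 0 <= phi x by exact: normal_pdf_ge0.
have fi' : (normal_prob 0 1).-integrable setT (EFin \o f).
  apply/integrableP; split; first exact/measurable_EFinP.
  rewrite ge0_integral_normal//; last first.
    by apply/measurable_EFinP; apply: measurableT_comp.
  move/integrableP: fi => [_]; apply: le_lt_trans.
  rewrite le_eqVlt; apply/orP; left; apply/eqP; apply: eq_integral => x _.
  by rewrite /= normrM EFinM (ger0_norm (phi0 x)).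
split=> //.
have dom := @normal_prob_dominates R 0 1.
rewrite -(@Radon_Nikodym_change_of_variables _ _ _ _ mu dom)//.
apply: ae_eq_integral => //.
- apply: emeasurable_funM => //; first exact/measurable_EFinP.
- exact: measurable_int fi.
- under [X in ae_eq _ _ _ X]eq_fun do rewrite EFinM.
  apply: ae_eqe_mul2l; apply: ae_eq_trans ae_eq_normal_density.
  exact/ae_eq_sym/ae_eq_Radon_Nikodym_SigmaFinite.
Qed.

Lemma integrable_normal_sqr :
  mu.-integrable setT (fun x => ((1 + x ^+ 2) * phi x)%:E).
Proof.
(* Domination by the normal density of standard deviation 2: the two exponentials differ by
   [expR (3 / 8 * x ^+ 2)], and 4 times this is at least [1 + x ^+ 2]. *)
pose k : R := 4 * normal_peak 1 / normal_peak 2.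
have p2 : 0 < normal_peak (2:R) by rewrite normal_peak_gt0// pnatr_eq0.
have p1 : 0 < normal_peak (1:R) by rewrite normal_peak_gt0// oner_eq0.
have hk : mu.-integrable setT (fun x => (k%:E * (normal_pdf 0 2 x)%:E)%E).
  by apply: integrableZl => //; exact: integrable_normal_pdf.
apply: (le_integrable measurableT _ _ hk).
- apply/measurable_EFinP; apply: measurable_funM.
    by apply: measurable_funD => //; exact: measurable_funX.
  exact: measurable_normal_pdf.
- move=> x _; rewrite -EFinM lee_fin !ger0_norm; last 2 first.
  + by rewrite mulr_ge0 ?normal_pdf_ge0// /k divr_ge0 ?mulr_ge0// ltW.
  + by rewrite mulr_ge0 ?normal_pdf_ge0// addr_ge0 ?sqr_ge0.
  rewrite normal_pdf01E normal_pdfE ?pnatr_eq0// /normal_fun subr0 /k.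
  have -> : 4 * normal_peak 1 / normal_peak 2 *
      (normal_peak 2 * expR (- x ^+ 2 / (2 ^+ 2 *+ 2))) =
      normal_peak 1 * (4 * expR (- x ^+ 2 / (2 ^+ 2 *+ 2))).
    by field; rewrite gt_eqF.
  rewrite mulrCA ler_pM2l// -ler_pdivlMr// ?expR_gt0//.
  have -> : - x ^+ 2 / (2 ^+ 2 *+ 2) = - (x ^+ 2 / 2) + 3 / 8 * x ^+ 2.
    by rewrite -mulr_natr; field.
  rewrite expRD mulrCA mulrC mulKf ?gt_eqF ?expR_gt0//.
  have := expR_ge1Dx (3 / 8 * x ^+ 2); have := sqr_ge0 x; lra.
Qed.

(** One constant must serve all 1-Lipschitz [h], since the Wasserstein distance is a supremum over
    them. The solution is [F = P / phi], where [P w] integrates the centred [h] against [phi] up to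
    [w]. *)
Lemma stein_equation : exists K : R, 0 < K /\
  forall h, (forall x y, `|h x - h y| <= `|x - y|) ->
  (normal_prob 0 1).-integrable setT (EFin \o h) /\
  exists F, let G w := w * F w + h w - fine (\int[normal_prob 0 1]_x (h x)%:E)%E in
  (forall w, `|G w| <= K) /\
  (forall x y, `|F y - F x - G x * (y - x)| <= K * (y - x) ^+ 2).
Proof.
have phi0 x : 0 <= phi x by exact: normal_pdf_ge0.
(* [c] bounds the distance from [h 0] to the normal mean of [h], uniformly in [h], because
   [|h x - h 0| <= 1 + x ^ 2]. *)
pose c := fine (\int[mu]_x ((1 + x ^+ 2) * phi x)%:E)%E.
have i2 := integrable_normal_sqr.
have c0 : 0 <= c.
  by apply/fine_ge0/integral_ge0 => x _; rewrite lee_fin mulr_ge0// addr_ge0// sqr_ge0.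
exists (10 * (c + 1)); split; first by rewrite mulr_gt0// ltr_wpDl.
move=> h hh.
have mh := measurable_lipschitz hh.
have hgr x : `|h x - h 0| <= 1 + x ^+ 2.
  have := hh x 0; rewrite subr0; have := normr_ge0 x.
  have := sqr_ge0 (`|x| - 1); rewrite sqrrB -normrX ger0_norm ?sqr_ge0//; lra.
have dom (f : R -> R) k : measurable_fun setT f -> (forall x, `|f x| <= k * (1 + x ^+ 2)) ->
    mu.-integrable setT (EFin \o (fun x => f x * phi x)).
  move=> mf fk.
  have k2 : mu.-integrable setT (fun x => k%:E * ((1 + x ^+ 2) * phi x)%:E)%E.
    exact: integrableZl.
  apply: (le_integrable measurableT _ _ k2).
    by apply/measurable_EFinP; apply: measurable_funM => //; exact: measurable_normal_pdf.
  move=> x _; rewrite -EFinM lee_fin mulrA !normrM -[`|k| * _]normrM ler_wpM2r//.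
  exact: le_trans (fk x) (ler_norm _).
have hk x : `|h x| <= (1 + `|h 0|) * (1 + x ^+ 2).
  have -> : h x = (h x - h 0) + h 0 by ring.
  apply: le_trans (ler_normD _ _) _; have := hgr x.
  have := normr_ge0 (h 0); have := sqr_ge0 x; nra.
have [hN ehN] := integrable_normal mh (dom _ _ mh hk).
split=> //.
set m := fine _.
pose H x := h x - m.
have mH : measurable_fun setT H by exact: measurable_funB.
have em : m = (\int[mu]_x (h x * phi x)) by rewrite /m ehN.
have iphi : mu.-integrable setT (EFin \o phi) by exact: integrable_normal_pdf.
have ephi : (\int[mu]_x phi x) = 1 :> R by rewrite /Rintegral integral_normal_pdf.
have Hsub a : (\int[mu]_x ((h x - a) * phi x)) = m - a.
  rewrite (_ : (fun x => _) = (fun x => h x * phi x - a * phi x)); last first.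
    by apply/funext => x; rewrite mulrBl.
  rewrite RintegralB//; last 2 first.
  - exact: dom hk.
  - exact: (integrableZl _ a iphi).
  by rewrite RintegralZl// ephi mulr1 -em.
have H0 : `|H 0| <= c.
  rewrite distrC -(Hsub (h 0)).
  have mh0 : measurable_fun setT (fun x => h x - h 0) by exact: measurable_funB.
  have ih0 : mu.-integrable setT (EFin \o (fun x => (h x - h 0) * phi x)).
    by apply: (dom _ 1) => // x; rewrite mul1r.
  apply: le_trans (le_normr_Rintegral _ ih0) _ => //.
  rewrite /c -/(Rintegral _ _ _); apply: le_Rintegral => //.
    exact: integrable_norm.
  by move=> x _; rewrite normrM (ger0_norm (phi0 x)) ler_wpM2r.
have Hk x : `|H x| <= (1 + c) * (1 + x ^+ 2).
  have -> : H x = (h x - h 0) + H 0 by rewrite /H; ring.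
  apply: le_trans (ler_normD _ _) _; have := hgr x; have := sqr_ge0 x; nra.
have iH := dom _ _ mH Hk.
pose P w := (\int[mu]_(x in `]-oo, w]) (H x * phi x)).
have dP w : is_derive w 1 P (H w * phi w).
  have ww : w < w + 1 by rewrite ltrDl.
  have iHw : mu.-integrable `]-oo, (w + 1)%R] (EFin \o (fun x => H x * phi x)).
    exact: integrableS iH.
  have cH : {for w, continuous (fun x => H x * phi x)}.
    apply: continuousM; last exact: continuous_normal_pdf.
    apply/cvgrPdist_le => e e0; near=> t.
    rewrite /H opprB addrA subrK; apply: le_trans (hh _ _) _; near: t.
    exact: cvgr_dist_le.
  have [dP eP] := @continuous_FTC1 R _ -oo%O w (w + 1) ww iHw (ltNyr _) cH.
  by rewrite -eP derive1E; exact/derivableP.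
(* Where [|x| >= w], multiplying the integrand by [|x| / w >= 1] leaves a finite second moment and
   gains the factor [1 / w]. *)
have tail D w : measurable D -> 0 < w -> (forall x, D x -> w <= `|x|) ->
    `|\int[mu]_(x in D) (H x * phi x)| <= (1 + c) * c / w.
  move=> mD w0 Dw.
  have iHD : mu.-integrable D (EFin \o (fun x => H x * phi x)) by exact: integrableS iH.
  apply: le_trans (le_normr_Rintegral _ iHD) _ => //.
  have i2c : mu.-integrable setT
      (EFin \o (fun x => (1 + c) / w * ((1 + x ^+ 2) * phi x))).
    exact: (integrableZl _ _ i2).
  apply: (@le_trans _ _ (\int[mu]_(x in D) ((1 + c) / w * ((1 + x ^+ 2) * phi x)))).
    apply: le_Rintegral => //.
    - exact: integrable_norm.
    - exact: integrableS i2c.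
    move=> x Dx; rewrite normrM (ger0_norm (phi0 x)) mulrA ler_wpM2r//.
    rewrite mulrAC ler_pdivlMr//.
    have h1 : `|H x| <= `|x| + c.
      have -> : H x = (h x - h 0) + H 0 by rewrite /H; ring.
      by apply: le_trans (ler_normD _ _) _; rewrite lerD//; have := hh x 0; rewrite subr0.
    have a1 : `|H x| * w <= `|H x| * `|x| by rewrite ler_wpM2l// Dw.
    have a2 : `|H x| * `|x| <= (`|x| + c) * `|x| by rewrite ler_wpM2r.
    have a3 : 0 <= c * (1 + `|x| ^+ 2 - `|x|).
      rewrite mulr_ge0// subr_ge0; have := sqr_ge0 (`|x| - 1); rewrite sqrrB.
      by have := normr_ge0 x; lra.
    have -> : x ^+ 2 = `|x| ^+ 2 by rewrite real_normK ?num_real.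
    rewrite expr2 in a3 *; lra.
  rewrite RintegralZl//; last exact: integrableS i2.
  rewrite mulrAC ler_wpM2r ?invr_ge0 ?(ltW w0)// ler_wpM2l ?addr_ge0//.
  rewrite /c /Rintegral fine_le ?integrable_fin_num//.
  - exact: integrableS i2.
  - apply: ge0_subset_integral => //; first exact: measurable_int i2.
    by move=> x _; rewrite lee_fin mulr_ge0// addr_ge0// sqr_ge0.
(* The centred function has total integral 0, so [P] is also minus the upper tail; this gives the
   decay required of [F] on both sides. *)
have P0 w : P w = - (\int[mu]_(x in `]w, +oo[) (H x * phi x)).
  apply/eqP; rewrite -addr_eq0 -Rintegral_setU//.
  - by rewrite -itv_bndbnd_setU ?bnd_simp// set_itvNyy Hsub subrr.
  - by rewrite -itv_bndbnd_setU ?bnd_simp// set_itvNyy.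
  - apply/disj_setPS => x /= [] /[!in_itv]/= xw /[!andbT] wx.
    by have := le_lt_trans xw wx; rewrite ltxx.
pose F w := (normal_peak 1)^-1 * (P w * expR (w ^+ 2 / 2)).
have p1 : 0 < normal_peak (1:R) by rewrite normal_peak_gt0// oner_eq0.
have dF w : is_derive w 1 F (w * F w + H w).
  have := dP w => dPw.
  have dE : is_derive w 1 (fun t : R => expR (t ^+ 2 / 2)) (w * expR (w ^+ 2 / 2)).
    by apply: is_derive_eq; rewrite /GRing.scale /=; field.
  rewrite /F; apply: is_derive_eq.
  rewrite normal_pdf01E expRN /GRing.scale /=; field.
  by rewrite !gt_eqF ?expR_gt0.
have H1 x y : `|H x - H y| <= `|x - y|.
  by rewrite /H opprB addrA subrK.
have [e b e0|hF1 hF2] := stein_solution_bounds c0 H1 H0 dF.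
  have p1' : 0 < (normal_peak (1:R))^-1 by rewrite invr_gt0.
  pose k := (normal_peak 1)^-1 * ((1 + c) * c).
  have k0 : 0 <= k by rewrite mulr_ge0 ?invr_ge0 ?mulr_ge0 ?addr_ge0// ltW.
  pose w := Num.max b (1 + k / e).
  have w1 : 1 + k / e <= w by rewrite le_max lexx orbT.
  have w0 : 0 < w by apply: lt_le_trans w1; rewrite ltr_pwDl// divr_ge0// ltW.
  have FP t : w ^+ 2 = t ^+ 2 -> `|P t| <= (1 + c) * c / w ->
      `|F t| * expR (- (w ^+ 2 / 2)) <= e.
    move=> wt Pt; rewrite /F !normrM -wt (ger0_norm (expR_ge0 _)) expRN mulrA.
    rewrite mulfK ?gt_eqF ?expR_gt0// (gtr0_norm p1').
    apply: (@le_trans _ _ (k / w)).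
      by rewrite /k -mulrA ler_wpM2l// invr_ge0 ltW.
    rewrite ler_pdivrMr// mulrC -ler_pdivrMr// (le_trans _ w1)//.
    by rewrite lerDr.
  exists w; first by rewrite le_max lexx.
  split; (apply: FP; first by rewrite ?sqrrN).
    rewrite P0 normrN tail// => x /=; rewrite in_itv/= andbT => /ltW xw.
    exact: le_trans (ler_norm _).
  rewrite /P tail// => x /=; rewrite in_itv/= => xw.
  by rewrite -normrN (le_trans _ (ler_norm _))// lerNr.
exists F => G; rewrite /G.
have eG w : w * F w + h w - m = w * F w + H w by rewrite /H addrA.
by split => [w|x y]; rewrite eG.
Unshelve. all: by end_near. Qed.
End normal.

(** * Wasserstein distance *)

Section glue.
Variables (R : realType) (m n : nat).
Notation Om := (attachment m n).
Local Notation q := (@ua_q R m n).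
Local Notation P := (@ua_prob R m n).

(** [ua_prob] is rewritten as a finite sum of scaled Dirac measures, whose integrals are
    evaluations. *)
Lemma ge0_integral_ua_prob (f : Om -> R) : (forall w, 0 <= f w) ->
  (\int[P]_w (f w)%:E = (avg q f)%:E)%E.
Proof.
move=> f0.
pose mu k : {measure set Om -> \bar R} :=
  if insub k is Some i then
    mscale (NngNum (ua_pmf_ge0 R (enum_val (i : 'I_#|{: Om}|))))
      (dirac (enum_val i))
  else mzero.
rewrite (eq_measure_integral (msum mu #|{: Om}|)); last first.
  move=> A _ _; rewrite /= /ua_prob /msum.
  rewrite (reindex (@enum_val _ {: Om})) /=; last first.
    by apply: onW_bij; exact: enum_val_bij.
  by apply: eq_bigr => i _; rewrite /mu valK.
rewrite ge0_integral_measure_sum//; last by move=> w _; rewrite lee_fin.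
rewrite /avg (reindex (@enum_val _ {: Om})) /=; last first.
  by apply: onW_bij; exact: enum_val_bij.
rewrite -sumEFin; apply: eq_bigr => i _; rewrite /mu valK.
rewrite ge0_integral_mscale//; last by move=> w _; rewrite lee_fin.
by rewrite integral_dirac// diracT mul1e EFinM.
Qed.

Lemma max0N (x : R) : Num.max x 0 - Num.max (- x) 0 = x.
Proof.
have [x0|/ltW x0] := leP 0 x.
  by rewrite (max_r (_ : - x <= 0)) ?subr0// oppr_le0.
by rewrite (max_l (_ : 0 <= - x)) ?sub0r ?opprK// oppr_ge0.
Qed.

Lemma integral_ua_prob (f : Om -> R) : (\int[P]_w (f w)%:E = (avg q f)%:E)%E.
Proof.
rewrite integralE.
under eq_integral do rewrite funeposE -EFin_max.
under [X in (_ - X)%E]eq_integral do rewrite funenegE -EFinN -EFin_max.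
rewrite !ge0_integral_ua_prob; try (by move=> w; rewrite le_max lexx orbT).
rewrite -EFinB -avgB; congr EFin; apply: avg_ext => w /=.
exact: max0N.
Qed.

Lemma integrable_ua_prob (f : Om -> R) : P.-integrable [set: Om] (EFin \o f).
Proof.
apply/integrableP; split => //.
by under eq_integral do rewrite /=; rewrite (integral_ua_prob (fun w => `|f w|)) ltry.
Qed.

Lemma copy_count_star l (w : Om) : (0 < l)%N ->
  copy_count R (star l) w = stars R l (@ua_inc m n) w.
Proof. by move=> l0; rewrite /copy_count card_copies_star. Qed.

Lemma mean_star l : (0 < l)%N -> mean R (star l) m n = avg q (stars R l (@ua_inc m n)).
Proof.
move=> l0; rewrite /mean unlock integral_ua_prob /=.
by apply: avg_ext => w; exact: copy_count_star.
Qed.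

Lemma sigma2_star l : (0 < l)%N -> sigma2 R (star l) m n = var q (stars R l (@ua_inc m n)).
Proof.
move=> l0; rewrite /sigma2 /variance unlock -/(mean R (star l) m n) mean_star//.
rewrite unlock integral_ua_prob /= (varE (@ua_q_sum1 R m n)).
by apply: avg_ext => w /=; rewrite !fctE /= copy_count_star// expr2.
Qed.

Lemma integral_law_star l (h : R -> R) : (0 < l)%N ->
  measurable_fun [set: measurableTypeR R] h ->
  (\int[law_standardized_count R (star l) m n]_x (h x)%:E =
   (avg q (fun w => h (standardized_count R (star l) w)))%:E)%E.
Proof.
move=> l0 mh; rewrite /law_standardized_count integral_distribution.
- exact: integral_ua_prob.
- exact/measurable_EFinP.
- exact: integrable_ua_prob.
Qed.

End glue.

Lemma avg_dev_le (R : realType) (I : finType) (T : I -> finType)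
    (q : forall p, T p -> R) (f : {dffun forall p, T p} -> R) (B : R) :
  (forall p x, 0 <= q p x) -> (forall p, \sum_x q p x = 1) ->
  var q f <= B -> avg q (fun w => `|f w - avg q f|) <= Num.sqrt B.
Proof.
move=> q0 q1 fB; rewrite -[leLHS]ger0_norm; last by apply: avg_ge0.
rewrite -sqrtr_sqr ler_wsqrtr// (le_trans (avg_sqr_le q0 q1 _))//.
rewrite (le_trans _ fB)// (varE q1) le_eqVlt; apply/orP; left; apply/eqP.
by apply: avg_ext => w; rewrite real_normK ?num_real.
Qed.

(** For each test function, Stein's equation turns the difference of expectations into minus the
    average of [Y w * F (Y w) - G (Y w)], which [stein_discrepancy] bounds uniformly. *)
Lemma wasserstein_star_le (R : realType) (m l : nat) (K : R) : (0 < l)%N ->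
  (forall h : R -> R, (forall x y, `|h x - h y| <= `|x - y|) ->
    (normal_prob 0 1).-integrable setT (EFin \o h) /\
    exists F : R -> R,
      let G w := w * F w + h w - fine (\int[normal_prob 0 1]_x (h x)%:E)%E in
      (forall w, `|G w| <= K) /\
      (forall x y, `|F y - F x - G x * (y - x)| <= K * (y - x) ^+ 2)) ->
  forall n (s : R),
  let q := @ua_q R m n in let f := stars R l (@ua_inc m n) in
  0 < s -> s ^+ 2 = sigma2 R (star l) m n ->
  (wasserstein (law_standardized_count R (star l) m n) (normal_prob 0 1) <=
   (K / s ^+ 2 * avg q (fun w => `|stein_kernel q f w - var q f|) +
    K / s ^+ 3 * (2^-1 * \sum_p avg q (fun w => avg q (fun v =>
       incr f p w v ^+ 2 * `|path_incr f p w v|))))%:E)%E.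
Proof.
move=> l0 hK n s q f s0 s2.
have s2v : s ^+ 2 = var q f by rewrite s2 sigma2_star.
have Ys w : standardized_count R (star l) w = (f w - avg q f) / s.
  rewrite /standardized_count copy_count_star// mean_star// /sigma -s2.
  by rewrite sqrtr_sqr gtr0_norm.
apply: ub_ereal_sup => _ [h hh <-].
have [hi [F [GK FK]]] := hK h hh.
rewrite integral_law_star//; last exact: measurable_lipschitz.
rewrite -[(\int[normal_prob 0 1]_x (h x)%:E)%E]fineK; last exact: integrable_fin_num.
rewrite -EFinB /= lee_fin.
set mu := fine _ in GK FK *.
pose G w := w * F w + h w - mu.
pose Y (w : {dffun forall p : 'I_n.-1 * 'I_m, 'I_p.1.+1}) := (f w - avg q f) / s.
have -> : avg q (fun w => h (standardized_count R (star l) w)) - mu =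
    - avg q (fun w => Y w * F (Y w) - G (Y w)).
  rewrite -[mu in LHS](avg_cst (@ua_q_sum1 R m n)) -avgB -[RHS]mulN1r -avgZ.
  by apply: avg_ext => w; rewrite Ys -/(Y w) /G; ring.
rewrite normrN.
exact: (stein_discrepancy (@ua_q_ge0 R m n) (@ua_q_sum1 R m n) s0 s2v GK FK).
Qed.

(** * Order of the variance and rate of convergence *)

Theorem theorem3p9 (R : realType) (m l : nat) (m_gt0 : (1 <= m)%N)
    (l_ge2 : (2 <= l)%N) :
  is_Theta (fun n => sigma2 R (star l) m n) (fun n => n%:R) /\
  exists C : R, \forall n \near \oo,
    (wasserstein (law_standardized_count R (star l) m n) (normal_prob 0 1)
      <= (C * n%:R `^ (- 2^-1))%:E)%E.
Proof.
have l0 : (0 < l)%N by exact: ltnW.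
have hM k : (0 < k)%N -> exists M : R, 0 <= M /\ forall n,
    moment (@ua_q R m n) (@ua_inc m n) k <= M * n%:R.
  move=> k0; have [M [M0 hM]] := ua_degree_moment R k.+1 m_gt0.
  exists ((6 ^ k * 3 ^ k.+1)%:R * (3 * M)); split; first by rewrite !mulr_ge0.
  move=> n; rewrite -!mulrA; apply: moment_le => //.
  - exact: ua_q_ge0.
  - exact: ua_q_sum1.
  - exact: ua_inc_card.
have [M1 [M10 hM1]] := hM l l0.
have [M2 [M20 hM2]] := hM (2 * l)%N (ltac:(by rewrite muln_gt0)).
have [M3 [M30 hM3]] := hM (3 * l)%N (ltac:(by rewrite muln_gt0)).
have [M4 [M40 hM4]] := hM (4 * l).+2 isT.
(* The numbers of stars through the edges have means of sum at most [M1 * n]; [M1] is the constant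
   [K] of the lower bound. *)
have [c [c0 [N hN]]] := var_stars_lower m_gt0 l_ge2 M10 (fun n =>
  le_trans (sum_stars_at_le l (@ua_q_ge0 R m n) (@ua_q_sum1 R m n) (@ua_inc m n)) (hM1 n)).
split.
  exists c, (Num.max c M2); split => //; first by rewrite le_max lexx.
  exists N => // n /= Nn; rewrite sigma2_star// hN//=.
  rewrite (le_trans (var_stars_le l (@ua_q_ge0 R m n) (@ua_q_sum1 R m n) _))//.
  by rewrite (le_trans (hM2 n))// ler_wpM2r// le_max lexx orbT.
have [K [K0 hK]] := stein_equation R.
pose kap := Num.sqrt c.
have kap0 : 0 < kap by rewrite sqrtr_gt0.
exists (K / kap ^+ 2 * Num.sqrt (4 * M4) + K / kap ^+ 3 * (2^-1 * M3)).
exists N.+1 => // n /= Nn.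
have n0 : 0 < n%:R :> R by rewrite ltr0n (leq_trans _ Nn).
pose r : R := Num.sqrt n%:R.
have r0 : 0 < r by rewrite sqrtr_gt0.
have r2 : r ^+ 2 = n%:R by rewrite sqr_sqrtr// ltW.
have hs2 := hN n (ltnW Nn).
pose s := Num.sqrt (sigma2 R (star l) m n).
have s2n : 0 < sigma2 R (star l) m n.
  by rewrite sigma2_star// (lt_le_trans _ hs2)// mulr_gt0.
have s0 : 0 < s by rewrite sqrtr_gt0.
have s2 : s ^+ 2 = sigma2 R (star l) m n by rewrite sqr_sqrtr// ltW.
have ks : kap * r <= s.
  by rewrite /kap /r /s -sqrtrM ?(ltW c0)// ler_wsqrtr// sigma2_star.
have kr0 : 0 < kap * r by rewrite mulr_gt0.
apply: le_trans (wasserstein_star_le l0 hK s0 s2) _.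
rewrite lee_fin powRN powR12_sqrt ?(ltW n0)// -/r mulrDl.
have KsX k : K / s ^+ k <= K / (kap * r) ^+ k.
  rewrite ler_wpM2l ?(ltW K0)// lef_pV2 ?posrE ?exprn_gt0//.
  by rewrite lerXn2r ?nnegrE ?(ltW kr0) ?(ltW s0).
(* With [s >= kap * r] and [r ^ 2 = n], the first term is of order [r ^- 2 * r] and the second of
   order [r ^- 3 * r ^ 2]. *)
apply: lerD.
  apply: (@le_trans _ _ (K / (kap * r) ^+ 2 * Num.sqrt (4 * M4 * n%:R))).
    apply: ler_pM; rewrite ?divr_ge0 ?exprn_ge0 ?(ltW K0) ?(ltW s0)//.
      by apply: (avg_ge0 (@ua_q_ge0 R m n) (@ua_q_sum1 R m n)).
    rewrite -[X in avg _ (fun w => `|_ - X|)](avg_stein_kernel (@ua_q_sum1 R m n)).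
    apply: (avg_dev_le (@ua_q_ge0 R m n) (@ua_q_sum1 R m n)).
    rewrite (le_trans (var_stein_kernel_le l (@ua_q_ge0 R m n) (@ua_q_sum1 R m n) _))//.
    by rewrite -mulrA ler_wpM2l.
  rewrite sqrtrM ?mulr_ge0// -/r le_eqVlt; apply/orP; left; apply/eqP.
  by field; rewrite !gt_eqF.
apply: (@le_trans _ _ (K / (kap * r) ^+ 3 * (2^-1 * (M3 * n%:R)))).
  apply: ler_pM; rewrite ?divr_ge0 ?exprn_ge0 ?(ltW K0) ?(ltW s0)//.
    rewrite mulr_ge0 ?invr_ge0// sumr_ge0// => p _.
    do 2 (apply: (avg_ge0 (@ua_q_ge0 R m n) (@ua_q_sum1 R m n)) => ?).
    by rewrite mulr_ge0// sqr_ge0.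
  rewrite ler_wpM2l ?invr_ge0//.
  exact: le_trans (cubic_stars_le l (@ua_q_ge0 R m n) (@ua_q_sum1 R m n) _) (hM3 n).
rewrite -r2 le_eqVlt; apply/orP; left; apply/eqP.
by field; rewrite !gt_eqF.
Qed.
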